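(* Let $\Bbbk$ be a field of characteristic zero and let $I\subsetneq \Bbbk[x_1,\dots,x_n]$ be a binomial ideal. Let $K\supseteq\Bbbk$ be an extension field large enough to contain the values of all saturations of the partial characters encountered below (for instance an algebraic closure of $\Bbbk$). Consider the following recursive procedure applied to $I$. (1) Determine whether the current ideal $I'$ is cellular. (a) If $I'$ is cellular with set of cell indices $\mathcal{E}$, compute its radical $(I'\cap\Bbbk[\mathcal{E}])+M(\mathcal{E})=M(\mathcal{E})+I_+(\sigma)$ and the partial character $(\mathcal{L},\sigma)$; compute all saturations $\tau_1,\dots,\tau_l$ of $\sigma$ with values in $K^*$ and save the ideals $P(\tau_i)=M(\mathcal{E})+I_+(\tau_i)$ of $K[x_1,\dots,x_n]$. (b) If $I'$ is not cellular, choose a variable $x_i$ that is a zerodivisor but not nilpotent modulo $I'$, and apply step (1) to each of the two ideals $I'+\langle x_i\rangle$ and $(I':x_i^{\infty})$. (2) From the collection of all saved ideals remove the redundant ones, i.e. keep only those that are minimal with respect to inclusion. This procedure terminates, all saved ideals are prime, and the ideals remaining after step (2) are exactly the minimal primes of $I\,K[x_1,\dots,x_n]$; in particular their intersection is the radical of $I\,K[x_1,\dots,x_n]$.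
   Context: A binomial ideal is an ideal generated by binomials (polynomials with at most two terms, so monomials are allowed). A proper binomial ideal $I'$ is cellular if each variable $x_i$ is either a nonzerodivisor or nilpotent modulo $I'$. Its set of cell indices is $\mathcal{E}=\{i : x_i \text{ is a nonzerodivisor modulo } I'\}\subseteq\{1,\dots,n\}$. Write $\Bbbk[\mathcal{E}]=\Bbbk[x_i:i\in\mathcal{E}]$ and $M(\mathcal{E})=\langle x_i: i\notin\mathcal{E}\rangle$. A partial character on $\mathbb{Z}^{\mathcal{E}}$ is a pair $(\mathcal{L},\sigma)$ where $\mathcal{L}\subseteq\mathbb{Z}^{\mathcal{E}}$ is a sublattice (subgroup) and $\sigma:\mathcal{L}\to \Bbbk^*$ is a group homomorphism to the multiplicative group of the coefficient field. The saturation of the lattice is $\operatorname{Sat}(\mathcal{L})=\{m\in\mathbb{Z}^{\mathcal{E}} : dm\in\mathcal{L}\text{ for some } d\in\mathbb{Z}\setminus\{0\}\}$. A saturation of $(\mathcal{L},\sigma)$ is a partial character $(\operatorname{Sat}(\mathcal{L}),\tau)$ with $\tau(l)=\sigma(l)$ for all $l\in\mathcal{L}$, with values in $K^*$; $K$ is required to be large enough that all saturations over an algebraic closure of $K$ already take values in $K^*$. The lattice ideal of a partial character is $I_+(\sigma)=\langle x^{m^+}-\sigma(m)x^{m^-} : m\in\mathcal{L}\rangle$, in the polynomial ring in the variables $x_i$, $i\in\mathcal{E}$, where $m=m^+-m^-$ with $m^+_i=\max\{m_i,0\}$ and $m^-_i=\max\{-m_i,0\}$. In $M(\mathcal{E})+I_+(\sigma)$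 the ideal $I_+(\sigma)$ is extended to the full polynomial ring. If $\mathcal{E}=\emptyset$, the lattice is $0$ and $I_+$ is the zero ideal. For every cellular $I'$, the ideal $I'\cap\Bbbk[\mathcal{E}]$ is a lattice ideal. *)

(* Defs.v *)
From HB Require Import structures.
From Stdlib Require Import Relation_Operators.
From mathcomp Require Import all_boot all_order all_algebra.
From mathcomp Require Import boolp classical_sets.
From mathcomp Require Import mpoly.

Set Implicit Arguments.
Unset Strict Implicit.
Unset Printing Implicit Defensive.

Import Order.TTheory GRing.Theory Num.Theory.

Local Open Scope classical_set_scope.
Local Open Scope ring_scope.

Section Ideals.
Variables (F : fieldType) (n : nat).
Local Notation R := {mpoly F[n]}.

(* The ideal of the subring A generated by a subset G of A. *)
Definition ideal_span_in (A G : set R) : set R :=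
  [set p | exists (r : nat) (a g : 'I_r -> R),
     [/\ forall j, A (a j), forall j, G (g j) & p = \sum_(j < r) a j * g j]].

Definition ideal_span (G : set R) : set R := ideal_span_in setT G.

Definition ideal_add (I J : set R) : set R :=
  [set p | exists a b : R, [/\ I a, J b & p = a + b]].

Definition radical (I : set R) : set R :=
  [set p | exists d : nat, I (p ^+ d)].

(* (I : q^oo) *)
Definition saturate (I : set R) (q : R) : set R :=
  [set p | exists d : nat, I (q ^+ d * p)].

Definition is_ideal (I : set R) : Prop :=
  [/\ I 0, forall p q, I p -> I q -> I (p + q)
    & forall p q, I q -> I (p * q)].

Definition is_proper (I : set R) : Prop := ~ I 1.

Definition prime_ideal (P : set R) : Prop :=
  [/\ is_ideal P, is_proper P & forall p q, P (p * q) -> P p \/ P q].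

Definition minimal_primes (I : set R) : set (set R) :=
  [set P | [/\ prime_ideal P, I `<=` P
    & forall Q, prime_ideal Q -> I `<=` Q -> Q `<=` P -> Q = P]].

Definition binomial (p : R) : Prop := (size (msupp p) <= 2)%N.

Definition binomial_ideal (I : set R) : Prop :=
  exists2 G : set R, (forall g, G g -> binomial g) & I = ideal_span G.

Definition nonzerodivisor_mod (I : set R) (q : R) : Prop :=
  forall p, I (q * p) -> I p.

Definition zerodivisor_mod (I : set R) (q : R) : Prop :=
  exists2 p, ~ I p & I (q * p).

Definition nilpotent_mod (I : set R) (q : R) : Prop :=
  exists d : nat, I (q ^+ d).

Definition cellular (I : set R) : Prop :=
  is_proper I /\
  forall i : 'I_n, nonzerodivisor_mod I 'X_i \/ nilpotent_mod I 'X_i.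

Definition cell_indices (I : set R) (E : {set 'I_n}) : Prop :=
  forall i : 'I_n, i \in E <-> nonzerodivisor_mod I 'X_i.

(* The subring F[x_i : i in E]. *)
Definition subring_in (E : {set 'I_n}) : set R :=
  [set p | forall m, m \in msupp p -> forall i, i \notin E -> m i = 0%N].

(* The ideal M(E) of the full polynomial ring. *)
Definition ideal_M (E : {set 'I_n}) : set R :=
  ideal_span [set p | exists2 i : 'I_n, i \notin E & p = 'X_i].

(* A partial character on Z^E, the latter being viewed as the set of vectors
   of Z^n supported on E.  Only the values of [pc_val] on [pc_lat] matter;
   [pc_valD] and [pc_val_neq0] make it a homomorphism from the lattice to the
   multiplicative group of F. *)
Record partial_character (E : {set 'I_n}) := PartialCharacter {
  pc_lat : set {ffun 'I_n -> int};
  pc_val : {ffun 'I_n -> int} -> F;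
  pc_supp : forall m, pc_lat m -> forall i, i \notin E -> m i = 0;
  pc_lat0 : pc_lat 0;
  pc_latB : forall m m', pc_lat m -> pc_lat m' -> pc_lat (m - m');
  pc_val_neq0 : forall m, pc_lat m -> pc_val m != 0;
  pc_valD : forall m m', pc_lat m -> pc_lat m' ->
    pc_val (m + m') = pc_val m * pc_val m'
}.

Definition pos_part (m : {ffun 'I_n -> int}) : 'X_{1..n} :=
  [multinom `|Num.max (m i) 0|%N | i < n].

Definition neg_part (m : {ffun 'I_n -> int}) : 'X_{1..n} :=
  [multinom `|Num.max (- m i) 0|%N | i < n].

(* I_+(sigma), an ideal of the subring F[x_i : i in E]. *)
Definition lattice_ideal E (sigma : partial_character E) : set R :=
  ideal_span_in (subring_in E)
    [set p | exists2 m, pc_lat sigma m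
      & p = 'X_[pos_part m] - pc_val sigma m *: 'X_[neg_part m]].

(* M(E) + I_+(sigma), the second summand being extended to the full ring. *)
Definition ideal_P E (sigma : partial_character E) : set R :=
  ideal_add (ideal_M E) (ideal_span (lattice_ideal sigma)).

Definition Sat (L : set {ffun 'I_n -> int}) : set {ffun 'I_n -> int} :=
  [set m | exists2 d : int, d != 0 & L (m *~ d)].

(* The variable x_i may be chosen to split the non-cellular ideal I. *)
Definition splitting_variable (I : set R) (i : 'I_n) : Prop :=
  [/\ ~ cellular I, zerodivisor_mod I 'X_i & ~ nilpotent_mod I 'X_i].

Definition split_add (I : set R) (i : 'I_n) : set R :=
  ideal_add I (ideal_span [set 'X_i]).

Definition split_sat (I : set R) (i : 'I_n) : set R := saturate I 'X_i.

Definition recursive_call (I J : set R) : Prop :=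
  exists2 i, splitting_variable I i & J = split_add I i \/ J = split_sat I i.

(* J occurs as a current ideal when the procedure is applied to I, for some
   choice of the splitting variables. *)
Definition reachable (I J : set R) : Prop :=
  clos_refl_trans (set R) recursive_call I J.

(* (L, sigma) is the partial character of the cellular ideal I. *)
Definition cell_data (I : set R) (E : {set 'I_n}) (sigma : partial_character E)
  : Prop :=
  [/\ cellular I, cell_indices I E & I `&` subring_in E = lattice_ideal sigma].

Definition remaining (S : set (set R)) : set (set R) :=
  [set P | S P /\ forall Q, S Q -> Q `<=` P -> Q = P].

End Ideals.

Section Procedure.
Variables (k K : fieldType) (iota : {rmorphism k -> K}) (n : nat).

Definition ideal_extension (I : set {mpoly k[n]}) : set {mpoly K[n]} :=
  ideal_span [set map_mpoly iota p | p in I].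

(* tau is a saturation, with values in the extension field K of k. *)
Definition saturation (E : {set 'I_n}) (sigma : partial_character k E)
    (tau : partial_character K E) : Prop :=
  pc_lat tau = Sat (pc_lat sigma) /\
  forall m, pc_lat sigma m -> pc_val tau m = iota (pc_val sigma m).

(* A finite list of saturations comprising all of them; characters are
   identified when they agree on their common lattice. *)
Definition all_saturations (E : {set 'I_n}) (sigma : partial_character k E)
    (l : nat) (tau : 'I_l -> partial_character K E) : Prop :=
  (forall j, saturation sigma (tau j)) /\
  forall tau', saturation sigma tau' ->
    exists j, forall m, pc_lat tau' m -> pc_val tau' m = pc_val (tau j) m.

(* Record of a complete execution: a binary tree of the recursive calls, where
   each leaf stores the results computed for a cellular ideal. *)
Inductive trace : Type :=
| Cell (E : {set 'I_n}) (sigma : partial_character k E)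
    (l : nat) (tau : 'I_l -> partial_character K E)
| Split (i : 'I_n) (t_add t_sat : trace).

Fixpoint execution (I : set {mpoly k[n]}) (t : trace) : Prop :=
  match t with
  | Cell E sigma l tau => cell_data I sigma /\ all_saturations sigma tau
  | Split i t_add t_sat =>
      [/\ splitting_variable I i, execution (split_add I i) t_add
        & execution (split_sat I i) t_sat]
  end.

Fixpoint saved (t : trace) : set (set {mpoly K[n]}) :=
  match t with
  | Cell E sigma l tau => [set P | exists j, P = ideal_P (tau j)]
  | Split _ t_add t_sat => saved t_add `|` saved t_sat
  end.

(* Whatever the choices of variables, there is no infinite chain of recursive
   calls, and every ideal that occurs can be processed to completion (so the
   procedure never gets stuck and each list of saturations is finite). *)
Definition terminates (I : set {mpoly k[n]}) : Prop :=
  Acc (fun J' J => recursive_call J J') I /\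
  forall J, reachable I J -> exists t, execution J t.

End Procedure.

Section LargeEnough.
Variables (k K Kbar : fieldType).
Variables (iota : {rmorphism k -> K}) (jota : {rmorphism K -> Kbar}) (n : nat).

(* All saturations of sigma over the extension Kbar of K have values in K. *)
Definition saturations_defined_over (E : {set 'I_n})
    (sigma : partial_character k E) : Prop :=
  forall tau : partial_character Kbar E, saturation (jota \o iota) sigma tau ->
    forall m, pc_lat tau m -> exists c : K, pc_val tau m = jota c.

(* K is large enough for all partial characters encountered in t. *)
Fixpoint large_enough (t : trace k K n) : Prop :=
  match t with
  | Cell E sigma _ _ => saturations_defined_over sigma
  | Split _ t_add t_sat => large_enough t_add /\ large_enough t_sat
  end.

End LargeEnough.

(* Main.v *)
Require Import Defs.
From HB Require Import structures.
From mathcomp Require Import all_boot all_order all_algebra.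
From mathcomp Require Import boolp classical_sets.
From mathcomp Require Import mpoly.
From mathcomp Require Import zify ring.

(** Over an algebraically closed field of characteristic 0, the ideal
   [ideal_P sigma] of a partial character is the ideal of all polynomials that
   vanish at its torus points, the points [v] with [v i != 0] exactly when [i] is
   in [E] and [v ^ m = sigma m] on the lattice ([lattice_nullstellensatz]).
   Indeed, monomials in different cosets of the lattice are distinct characters
   on the torus points, since characters of lattices extend and a vector outside
   a lattice is detected by a character of the quotient; and distinct characters
   are independent ([torus_independence]).

   The statements about a cellular ideal follow.  A vanishing ideal is radical,
   which computes the radical ([cell_radical]).  The restriction of a torus point
   to the saturation of the lattice is one of the saturations of [sigma], so the
   torus points of [sigma] are those of its saturations, and the intersection of
   the ideals saved at a leaf lies in the radical
   ([bigcap_saturations_sub_radical]).  When the lattice is saturated, torus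
   points can be moved along curves with integer weights that separate any
   finitely many of its cosets, which makes the ideal prime
   ([saturated_ideal_P_prime]).

   That every cellular binomial ideal comes from a partial character, and that
   the ideals of the recursion remain binomial, both rest on the fact that a
   member of a binomial ideal is a sum of binomials of the ideal supported on its
   own monomials ([binomial_ideal_support]).  The recursion terminates because it
   decreases lexicographically the numbers of non-nilpotent variables and of
   zerodivisors among the variables ([recursive_call_measure]).

   Finally the radical of an ideal is recovered from its two branches
   ([radical_split]), so the saved ideals are primes over the extended ideal whose
   intersection is its radical.  A prime over the extended ideal then contains one
   of these finitely many ideals ([saved_sub_prime]), and the minimal saved ideals
   are the minimal primes. *)

Set Implicit Arguments.
Unset Strict Implicit.
Unset Printing Implicit Defensive.

Import Order.TTheory GRing.Theory Num.Theory.

Local Open Scope classical_set_scope.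
Local Open Scope ring_scope.

(** * Ideals, radicals and saturations *)

Section IdealTheory.
Variables (F : fieldType) (n : nat).
Local Notation R := {mpoly F[n]}.
Implicit Types (I J P : set R) (p q : R).

Lemma is_ideal0 I : is_ideal I -> I 0. Proof. by case. Qed.

Lemma is_idealD I p q : is_ideal I -> I p -> I q -> I (p + q).
Proof. by case=> _ H _; exact: H. Qed.

Lemma is_idealM I p q : is_ideal I -> I q -> I (p * q).
Proof. by case=> _ _ H; exact: H. Qed.

Lemma is_idealMr I p q : is_ideal I -> I p -> I (p * q).
Proof. by move=> Iid Ip; rewrite mulrC; apply: is_idealM. Qed.

Lemma is_idealN I p : is_ideal I -> I p -> I (- p).
Proof. by move=> Iid Ip; rewrite -mulN1r; apply: is_idealM. Qed.

Lemma is_idealB I p q : is_ideal I -> I p -> I q -> I (p - q).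
Proof. by move=> Iid Ip Iq; apply: is_idealD => //; apply: is_idealN. Qed.

Lemma is_idealZ I c p : is_ideal I -> I p -> I (c *: p).
Proof. by move=> Iid Ip; rewrite -mul_mpolyC; apply: is_idealM. Qed.

Lemma is_ideal_sum I (T : Type) (r : seq T) (Q : pred T) (f : T -> R) :
  is_ideal I -> (forall j, Q j -> I (f j)) -> I (\sum_(j <- r | Q j) f j).
Proof.
move=> Iid If; apply: (big_ind I) => //; first exact: is_ideal0.
by move=> p q; apply: is_idealD.
Qed.

Lemma ideal_span_in0 (A G : set R) : ideal_span_in A G 0.
Proof.
exists 0%N, (fun=> 0), (fun=> 0); rewrite big_ord0; split=> // j; by case: j.
Qed.

Lemma ideal_span_inD (A G : set R) p q :
  ideal_span_in A G p -> ideal_span_in A G q -> ideal_span_in A G (p + q).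
Proof.
move=> [r [a [g [Aa Gg ->]]]] [s [b [h [Ab Gh ->]]]].
exists (r + s)%N,
  (fun j => match split j with inl j' => a j' | inr j' => b j' end),
  (fun j => match split j with inl j' => g j' | inr j' => h j' end).
split; first by move=> j; case: split.
  by move=> j; case: split.
rewrite big_split_ord /=; congr (_ + _); apply: eq_bigr => j _.
  case: splitP => [j' /= e | k /= e]; last by move: (ltn_ord j); lia.
  by rewrite (_ : j = j') //; apply: val_inj.
case: splitP => [j' /= e | k /= /addnI e]; first by move: (ltn_ord j'); lia.
by rewrite (_ : j = k) //; apply: val_inj.
Qed.

Lemma ideal_span_in_gen (A G : set R) a g :
  A a -> G g -> ideal_span_in A G (a * g).
Proof.
by move=> Aa Gg; exists 1%N, (fun=> a), (fun=> g); rewrite big_ord1.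
Qed.

Lemma ideal_span_is_ideal (G : set R) : is_ideal (ideal_span G).
Proof.
split; [exact: ideal_span_in0 | by move=> p q; exact: ideal_span_inD |].
move=> p q [r [a [g [_ Gg ->]]]]; exists r, (fun j => p * a j), g; split=> //.
by rewrite mulr_sumr; apply: eq_bigr => j _; rewrite mulrA.
Qed.

Lemma ideal_span_gen (G : set R) : G `<=` ideal_span G.
Proof. by move=> g Gg; rewrite -[g]mul1r; apply: ideal_span_in_gen. Qed.

Lemma ideal_span_in_sub (A G : set R) I :
  is_ideal I -> G `<=` I -> ideal_span_in A G `<=` I.
Proof.
move=> Iid GI p [r [a [g [_ Gg ->]]]]; apply: is_ideal_sum => // j _.
by apply: is_idealM => //; apply: GI.
Qed.

Lemma ideal_span_sub (G : set R) I : is_ideal I -> G `<=` I -> ideal_span G `<=` I.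
Proof. exact: ideal_span_in_sub. Qed.

Lemma ideal_add_is_ideal I J : is_ideal I -> is_ideal J -> is_ideal (ideal_add I J).
Proof.
move=> Iid Jid; split.
- by exists 0, 0; rewrite addr0; split=> //; exact: is_ideal0.
- move=> _ _ [a [b [Ia Jb ->]]] [c [d [Ic Jd ->]]].
  exists (a + c), (b + d); split; [exact: is_idealD|exact: is_idealD|].
  by rewrite addrACA.
- move=> p _ [a [b [Ia Jb ->]]]; exists (p * a), (p * b).
  by rewrite mulrDr; split=> //; apply: is_idealM.
Qed.

Lemma ideal_addl I J : is_ideal J -> I `<=` ideal_add I J.
Proof. by move=> Jid p Ip; exists p, 0; rewrite addr0; split=> //; exact: is_ideal0. Qed.

Lemma ideal_addr I J : is_ideal I -> J `<=` ideal_add I J.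
Proof. by move=> Iid p Jp; exists 0, p; rewrite add0r; split=> //; exact: is_ideal0. Qed.

Lemma ideal_add_sub I J P : is_ideal P -> I `<=` P -> J `<=` P -> ideal_add I J `<=` P.
Proof.
by move=> Pid IP JP _ [a [b [Ia Jb ->]]]; apply: is_idealD => //; [apply: IP|apply: JP].
Qed.

Lemma ideal_addC I J : ideal_add I J = ideal_add J I.
Proof.
by apply/seteqP; split=> _ [a [b [Ia Jb ->]]]; exists b, a; rewrite addrC.
Qed.

Lemma is_idealX I p d e : is_ideal I -> (d <= e)%N -> I (p ^+ d) -> I (p ^+ e).
Proof. by move=> Iid /subnK <- Ip; rewrite exprD; apply: is_idealM. Qed.

Lemma sub_radical I : I `<=` radical I.
Proof. by move=> p Ip; exists 1%N. Qed.

Lemma radical_is_ideal I : is_ideal I -> is_ideal (radical I).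
Proof.
move=> Iid; split.
- by exists 1%N; rewrite expr1; exact: is_ideal0.
- move=> p q [d Ip] [e Iq]; exists (d + e)%N; rewrite exprDn.
  apply: is_ideal_sum => // i _; rewrite -mulr_natr; apply: is_idealMr => //.
  case: (leqP d (d + e - i)) => h; first by apply: is_idealMr; last exact: is_idealX h _.
  by apply: is_idealM; last (apply: is_idealX Iq => //; lia).
- by move=> p q [d Iq]; exists d; rewrite exprMn; apply: is_idealM.
Qed.

Lemma prime_idealX P p d : prime_ideal P -> P (p ^+ d) -> P p.
Proof.
move=> [Pid P1 Pm]; elim: d => [|d IH]; first by rewrite expr0 => /P1.
by rewrite exprS => /Pm[].
Qed.

Lemma radical_sub_prime I P : prime_ideal P -> I `<=` P -> radical I `<=` P.
Proof. by move=> Pp IP p [d /IP]; apply: prime_idealX. Qed.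

Lemma saturate_is_ideal I q : is_ideal I -> is_ideal (saturate I q).
Proof.
move=> Iid; split.
- by exists 0%N; rewrite mulr0; exact: is_ideal0.
- move=> a b [d Ia] [e Ib]; exists (d + e)%N.
  rewrite mulrDr; apply: is_idealD => //.
    by rewrite exprD -mulrA [q ^+ e * a]mulrC mulrA; apply: is_idealMr.
  by rewrite exprD -mulrA; apply: is_idealM.
- by move=> a b [d Ib]; exists d; rewrite mulrCA; apply: is_idealM.
Qed.

Lemma sub_saturate I q : I `<=` saturate I q.
Proof. by move=> p Ip; exists 0%N; rewrite mul1r. Qed.

Lemma binomial_ideal_is_ideal I : binomial_ideal I -> is_ideal I.
Proof. by case=> G _ ->; apply: ideal_span_is_ideal. Qed.

Lemma nonzerodivisor_modX I q d p :
  nonzerodivisor_mod I q -> I (q ^+ d * p) -> I p.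
Proof.
move=> nz; elim: d => [|d IH]; first by rewrite mul1r.
by rewrite exprS -mulrA => /nz.
Qed.

Lemma not_nonzerodivisor_mod I q : ~ nonzerodivisor_mod I q -> zerodivisor_mod I q.
Proof. by move/existsNP=> [p /not_implyP[Iqp nIp]]; exists p. Qed.

End IdealTheory.

(** * Binomial ideals *)

Local Notation binomial := Defs.binomial.

Section BinomialIdeals.
Variables (F : fieldType) (n : nat).
Local Notation R := {mpoly F[n]}.
Implicit Types (I J : set R) (p q b : R) (s : seq R).

Lemma binomial_sub p q : {subset msupp p <= msupp q} -> binomial q -> binomial p.
Proof. by move=> pq; apply: leq_trans; apply: uniq_leq_size. Qed.

Lemma binomial_monomial_mul c m q : binomial q -> binomial (c *: 'X_[m] * q).
Proof.
move=> bq; rewrite -scalerAl mulrC; apply: (binomial_sub (q := q * 'X_[m])).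
  exact: msuppZ_le.
by rewrite /binomial (perm_size (msuppMX q m)) size_map.
Qed.

(** A monomial [m] whose coefficients add up to 0 can be removed from all the
   terms of a sum of binomials: subtract from each term the multiple of one
   fixed term [b1] that cancels [m].  The difference has at most one monomial
   left from the term and one from [b1], and the multiples of [b1] add up
   to 0. *)
Lemma binomial_elim I s m :
  is_ideal I -> (forall b, b \in s -> I b /\ binomial b) ->
  (\sum_(b <- s) b)@_m = 0 ->
  exists2 s', \sum_(b <- s) b = \sum_(b <- s') b &
    forall b, b \in s' -> [/\ I b, binomial b & forall m', m' \in msupp b ->
      m' != m /\ exists2 c, c \in s & m' \in msupp c].
Proof.
move=> Iid sI; rewrite raddf_sum /= => sum0.
have [/allP s0|/allPn[b1 b1s b1m]] := boolP (all (fun b => b@_m == 0) s).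
  exists s => // b bs; have [Ib bb] := sI b bs; split=> // m' m'b.
  split; last by exists b.
  by apply: contraTneq m'b => ->; rewrite -mcoeff_eq0 s0.
exists [seq b - (b@_m / b1@_m) *: b1 | b <- s].
  rewrite big_map big_split /= sumrN -scaler_suml -mulr_suml sum0.
  by rewrite mul0r scale0r subr0.
have [Ib1 bb1] := sI b1 b1s.
move=> _ /mapP[b bs ->]; have [Ib bb] := sI b bs.
set b' := b - _.
have b'm : m \notin msupp b'.
  by rewrite -mcoeff_eq0 mcoeffB mcoeffZ divfK ?subrr.
have b'sub : {subset msupp b' <= msupp b ++ msupp b1}.
  move=> m' /msuppB_le; rewrite !mem_cat => /orP[->//|/msuppZ_le ->].
  by rewrite orbT.
split.
- by apply: is_idealB => //; apply: is_idealZ.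
- have [bm0|bm0] := eqVneq b@_m 0.
    by rewrite /b' bm0 mul0r scale0r subr0.
  have le1 (c : R) : c@_m != 0 -> binomial c -> (size (rem m (msupp c)) <= 1)%N.
    by rewrite -mcoeff_msupp => cm; rewrite /binomial size_rem //; case: (size _) => [|[|[]]].
  apply: (@leq_trans (size (rem m (msupp b) ++ rem m (msupp b1)))).
    apply: uniq_leq_size => // m' m'b'.
    have m'm : m' != m by apply: contraNneq b'm => <-.
    by move/b'sub: m'b'; rewrite !mem_cat !mem_rem_uniq ?msupp_uniq // !inE m'm.
  rewrite size_cat; have := le1 b bm0 bb; have := le1 b1 b1m bb1; lia.
- move=> m' m'b'; split; first by apply: contraNneq b'm => <-.
  by move/b'sub: m'b'; rewrite mem_cat => /orP[]; [exists b|exists b1].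
Qed.

(** This controls which binomials are needed to write a member of the ideal: the
   monomials outside its support are eliminated one at a time. *)
Lemma binomial_ideal_support I p : binomial_ideal I -> I p ->
  exists2 s, p = \sum_(b <- s) b &
    forall b, b \in s -> [/\ I b, binomial b & {subset msupp b <= msupp p}].
Proof.
move=> Ib Ip; have Iid := binomial_ideal_is_ideal Ib.
have [s [ps sI]] : exists s, p = \sum_(b <- s) b /\
    forall b, b \in s -> I b /\ binomial b.
  case: Ib Ip Iid => G Gb -> [r [a [g [_ Gg ->]]]] Iid.
  exists [seq (a j)@_m *: 'X_[m] * g j | j <- enum 'I_r, m <- msupp (a j)]; split.
    rewrite big_allpairs_dep /= big_enum /=; apply: eq_bigr => j _.
    by rewrite {1}[a j]mpolyE mulr_suml.
  move=> _ /allpairsPdep[j [m [_ _ ->]]]; split.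
    by apply: is_idealM => //; apply: ideal_span_gen.
  exact/binomial_monomial_mul/Gb.
have [t st] : exists t : seq 'X_{1..n}, forall (b : R) m, b \in s -> m \in msupp b ->
    m \in msupp p \/ m \in t.
  exists (flatten [seq msupp b | b <- s]) => b m bs mb; right.
  by apply/flattenP; exists (msupp b) => //; apply: map_f.
elim: t s ps sI st => [|m t IH] s ps sI st.
  exists s => // b bs; have [Ib' bb] := sI b bs; split=> // m /(st b m bs).
  by case.
have [mp|mp] := boolP (m \in msupp p).
  apply: (IH s) => // b m' bs /(st b m' bs)[|]; first by left.
  by rewrite inE => /predU1P[->|]; [left|right].
have [|s' ss' s'I] := binomial_elim Iid sI (m := m).
  by rewrite -ps; apply: memN_msupp_eq0.
apply: (IH s'); first by rewrite ps.
  by move=> b /s'I[].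
move=> b m' /s'I[_ _ H] /H[m'm [c cs m'c]].
have [|] := st c m' cs m'c; first by left.
by rewrite inE (negPf m'm); right.
Qed.

Lemma binomial_ideal_of_support I : is_ideal I ->
  (forall p, I p -> exists2 s, p = \sum_(b <- s) b &
    forall b, b \in s -> I b /\ binomial b) -> binomial_ideal I.
Proof.
move=> Iid H; exists [set b | I b /\ binomial b]; first by move=> b [].
apply/seteqP; split=> p.
  move/H => [s -> sI]; rewrite big_seq; apply: is_ideal_sum.
    exact: ideal_span_is_ideal.
  by move=> b /sI; apply: ideal_span_gen.
by apply: ideal_span_sub => // b [].
Qed.

(** All the monomials of [x_i ^ d p] are multiples of [x_i ^ d], hence so are the
   binomials that express it in [I]; divided by [x_i ^ d], they express [p] in
   the saturation. *)
Lemma binomial_ideal_saturate I i : binomial_ideal I -> binomial_ideal (split_sat I i).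
Proof.
move=> Ib; have Iid := binomial_ideal_is_ideal Ib.
apply: binomial_ideal_of_support; first exact: saturate_is_ideal.
move=> p [d Ip]; have [s ps sI] := binomial_ideal_support Ib Ip.
rewrite mpolyXn mulrC in ps sI.
set m := (U_(i) *+ d)%MM in ps sI.
have {sI} [s' ss' s'I] : exists2 s', s = [seq b * 'X_[m] | b <- s'] &
    forall b, b \in s' -> split_sat I i b /\ binomial b.
  elim: s sI {ps} => [|b s IH] sI; first by exists [::].
  have [|s' -> s'I] := IH; first by move=> c cs; apply: sI; rewrite inE cs orbT.
  have [Ib' bb bsub] := sI b (mem_head _ _).
  pose b' := \sum_(m' <- msupp p) b@_(m + m') *: 'X_[m'].
  have bb' : b = b' * 'X_[m].
    apply/mpolyP => m'; have [mm'|mm'] := boolP (m <= m')%MM; last first.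
      rewrite !memN_msupp_eq0 //.
        apply: contraNN mm'; rewrite (perm_mem (msuppMX _ _)) => /mapP[m2 _ ->].
        exact: lem_addr.
      apply: contraNN mm' => /bsub; rewrite (perm_mem (msuppMX _ _)).
      by move=> /mapP[m2 _ ->]; apply: lem_addr.
    rewrite -(submK mm') addmC mcoeffMX addmC.
    rewrite raddf_sum /=.
    have [m'p|m'p] := boolP ((m' - m)%MM \in msupp p).
      rewrite (bigD1_seq (m' - m)%MM) //= mcoeffZ mcoeffX eqxx mulr1.
      rewrite big1 ?addr0 1?addmC // => m2 /negPf m2n.
      by rewrite mcoeffZ mcoeffX m2n mulr0.
    rewrite memN_msupp_eq0 ?big1_seq // => [m2 /= m2p|].
      rewrite mcoeffZ mcoeffX; case: eqP m2p m'p => [->->//|]; by rewrite mulr0.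
    apply: contraNN m'p => /bsub; rewrite (perm_mem (msuppMX _ _)) addmC.
    by move=> /mapP[m2 m2p /addmI ->].
  exists (b' :: s'); first by rewrite /= -bb'.
  move=> c; rewrite inE => /predU1P[->|/s'I//]; split.
    by exists d; rewrite mpolyXn -/m mulrC -bb'.
  by move: bb; rewrite bb' /binomial (perm_size (msuppMX _ _)) size_map.
exists s' => //; have : p * 'X_[m] = (\sum_(b <- s') b) * 'X_[m].
  by rewrite mulr_suml ps ss' big_map.
apply: mulIf; rewrite -msupp_eq0 msuppX //.
Qed.

Lemma binomial_ideal_add_var I i : binomial_ideal I -> binomial_ideal (split_add I i).
Proof.
move=> [G Gb ->].
exists (G `|` [set 'X_i]); first by move=> g [/Gb//|->]; rewrite /binomial msuppX.
apply/seteqP; split.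
  apply: ideal_add_sub; first exact: ideal_span_is_ideal.
    apply: ideal_span_sub; first exact: ideal_span_is_ideal.
    by move=> g Gg; apply: ideal_span_gen; left.
  apply: ideal_span_sub; first exact: ideal_span_is_ideal.
  by move=> g Gg; apply: ideal_span_gen; right.
apply: ideal_span_sub.
  by apply: ideal_add_is_ideal; apply: ideal_span_is_ideal.
move=> g [Gg|Xg].
  by apply: ideal_addl; [exact: ideal_span_is_ideal|exact: ideal_span_gen].
by apply: ideal_addr; [exact: ideal_span_is_ideal|exact: ideal_span_gen].
Qed.

End BinomialIdeals.

(** * Sublattices of Z^n and homomorphisms to divisible groups *)

Section Subgroups.

Definition subgroup (V : zmodType) (A : set V) : Prop :=
  A 0 /\ forall a b, A a -> A b -> A (a - b).

Lemma subgroupN (V : zmodType) (A : set V) a : subgroup A -> A a -> A (- a).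
Proof. by move=> [A0 AB] Aa; rewrite -sub0r; apply: AB. Qed.

Lemma subgroupD (V : zmodType) (A : set V) a b :
  subgroup A -> A a -> A b -> A (a + b).
Proof.
move=> sA Aa Ab; by rewrite -[b]opprK; case: (sA) => _ AB; apply: AB => //; apply: subgroupN.
Qed.

Lemma subgroupMz (V : zmodType) (A : set V) a z : subgroup A -> A a -> A (a *~ z).
Proof.
move=> sA Aa; have AMn d : A (a *+ d).
  elim: d => [|d IH]; first by rewrite mulr0n; case: sA.
  by rewrite mulrS; apply: subgroupD.
case: z => d; first exact: AMn.
by rewrite NegzE mulrNz; apply: subgroupN sA (AMn d.+1).
Qed.

Lemma int_subgroup_principal (A : set int) :
  subgroup A -> exists2 d, A d & forall a, A a -> exists q, a = q * d.
Proof.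
move=> sA; have [A_triv|] := pselect (A `<=` [set 0]).
  exists 0; first by case: sA.
  by move=> a /A_triv->; exists 0; rewrite mul0r.
move/existsNP=> [a /not_implyP[Aa /eqP a0]].
have exd : exists d : nat, `[< (0 < d)%N /\ A d%:Z >].
  exists `|a|%N; apply/asboolP; split; first by rewrite absz_gt0.
  by case: (intP a) Aa {a0} => // d; rewrite ?abszN // => /(subgroupN sA); rewrite opprK.
case: (ex_minnP exd) => d /asboolP[d_gt0 Ad] d_min; exists d%:Z => // b Ab.
exists (b %/ d%:Z)%Z; have := divz_eq b d%:Z.
have d0 : d%:Z != 0 by lia.
have := modz_ge0 b d0; have := ltz_pmod b (d_gt0 : 0 < d%:Z).
have : A (b %% d%:Z)%Z.
  rewrite /modz mulrC -mulrzz.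
  by case: (sA) => _ AB; apply: AB => //; apply: subgroupMz.
case: (b %% d%:Z)%Z => // r Ar r_lt _ bE.
case: r Ar r_lt bE => [|r] Ar r_lt bE; first by rewrite {1}bE addr0.
have /d_min : `[< (0 < r.+1)%N /\ A r.+1%:Z >] by apply/asboolP.
by move: r_lt; lia.
Qed.

End Subgroups.

Section Lattices.
Variable n : nat.
Local Notation Zn := {ffun 'I_n -> int}.
Implicit Types (L : set Zn) (m : Zn).

Lemma int_ffunMz m (q : int) i : (m *~ q) i = m i * q.
Proof. by rewrite ffunMzE mulrzz. Qed.

(** Hermite normal form: vectors adapted to the flag of coordinate subspaces.
   The diagonal entry, possibly 0, generates the group of last coordinates of
   the lattice vectors in the corresponding subspace. *)
Lemma lattice_echelon L : subgroup L ->
  exists g : 'I_n -> Zn, forall i : 'I_n,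
    [/\ L (g i), forall j : 'I_n, (i < j)%N -> g i j = 0 &
      forall m, L m -> (forall j : 'I_n, (i < j)%N -> m j = 0) ->
        exists q, m i = q * g i i].
Proof.
move=> sL.
suff /choice[g gP] : forall i : 'I_n, exists gi : Zn, (fun (i : 'I_n) (gi : Zn) =>
  [/\ L gi, forall j : 'I_n, (i < j)%N -> gi j = 0 &
  forall m, L m -> (forall j : 'I_n, (i < j)%N -> m j = 0) ->
    exists q, m i = q * gi i]) i gi by exists g.
move=> i.
pose A : set int := [set a | exists2 m, L m /\
  (forall j : 'I_n, (i < j)%N -> m j = 0) & a = m i].
have [|_ [gi [Lgi gi0] ->] Agen] := @int_subgroup_principal A.
  split; first by exists 0; rewrite ?ffunE //; split=> [|j _]; [case: sL|rewrite ffunE].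
  move=> _ _ [m [Lm m0] ->] [m' [Lm' m'0] ->]; exists (m - m'); last by rewrite !ffunE.
  split; first by case: sL => _ LB; apply: LB.
  by move=> j ij; rewrite !ffunE m0 // m'0 // subr0.
by exists gi; split=> // m Lm m0; apply: Agen; exists m.
Qed.

Lemma lattice_fingen L : subgroup L ->
  exists g : 'I_n -> Zn, (forall i, L (g i)) /\
    forall m, L m -> exists c : 'I_n -> int, m = \sum_i g i *~ c i.
Proof.
move=> sL; have [g gP] := lattice_echelon sL.
suff step N : (N <= n)%N -> forall m, L m ->
    (forall j : 'I_n, (N <= j)%N -> m j = 0) ->
    exists c : 'I_n -> int, m = \sum_i g i *~ c i.
  exists g; split=> [i|m Lm]; first by case: (gP i).
  by apply: (step n) => // j; rewrite leqNgt ltn_ord.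
elim: N => [|N IH] Nn m Lm m0.
  exists (fun=> 0); rewrite big1 => [|i _]; last by rewrite mulr0z.
  by apply/ffunP => i; rewrite ffunE m0.
pose i := Ordinal Nn; case: (gP i) => Lgi gi0 /(_ m Lm)[].
  by move=> j ij; apply: m0.
move=> q mq; have [|||c cE] := IH _ (m - g i *~ q); first exact: ltnW.
- by case: (sL) => _ LB; apply: LB => //; apply: subgroupMz.
- move=> j; rewrite leq_eqVlt => /predU1P[Nj|Nj].
    have -> : j = i by apply: val_inj.
    by rewrite !ffunE int_ffunMz mq mulrC subrr.
  by rewrite !ffunE int_ffunMz gi0 // m0 // mul0r subr0.
exists (fun j => c j + (if j == i then q else 0)).
rewrite -[LHS](subrK (g i *~ q)) cE.
rewrite [in RHS](eq_bigr (fun j => g j *~ c j + (if j == i then g j *~ q else 0))).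
  by rewrite big_split /= -big_mkcond big_pred1_eq.
by move=> j _; rewrite mulrzDr; case: eqP; rewrite ?mulr0z.
Qed.

Lemma fst_mulz (V : zmodType) (x : Zn * V) z : (x *~ z).1 = x.1 *~ z.
Proof. exact: (raddfMz fst). Qed.

Lemma snd_mulz (V : zmodType) (x : Zn * V) z : (x *~ z).2 = x.2 *~ z.
Proof. exact: (raddfMz snd). Qed.

(** Divisible groups are injective: a homomorphism from a sublattice of Z^n,
   given by its graph [G], extends to Z^n, where it is determined by the
   images [u i] of the standard basis vectors.  These images are found one
   coordinate at a time, dividing by the nonzero diagonal entries of an echelon
   family. *)
Lemma divisible_extension (V : zmodType) (G : set (Zn * V)) :
  (forall (v : V) (d : int), d != 0 -> exists w, w *~ d = v) ->
  subgroup G -> (forall v, G (0, v) -> v = 0) ->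
  exists u : 'I_n -> V, forall m v, G (m, v) -> v = \sum_i u i *~ m i.
Proof.
move=> divV sG G_fun.
have [|g gP] := @lattice_echelon [set m | exists v, G (m, v)].
  split; first by exists 0; case: sG.
  by move=> m m' [v Gm] [v' Gm']; exists (v - v'); case: sG => _ /(_ _ _ Gm Gm').
suff step N : (N <= n)%N -> exists u : 'I_n -> V, forall m v, G (m, v) ->
    (forall j : 'I_n, (N <= j)%N -> m j = 0) -> v = \sum_i u i *~ m i.
  have [u uP] := step n (leqnn n).
  by exists u => m v Gm; apply: uP => // j; rewrite leqNgt ltn_ord.
elim: N => [|N IH] Nn.
  exists (fun=> 0) => m v Gm m0; have mE : m = 0 by apply/ffunP => i; rewrite ffunE m0.
  by rewrite mE in Gm; rewrite (G_fun v Gm) big1 // => i _; rewrite mul0rz.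
have [u uP] := IH (ltnW Nn); pose i := Ordinal Nn.
case: (gP i) => -[w Gw] gi0 gi_gen.
have [gii|gii] := eqVneq (g i i) 0.
  exists u => m v Gm m0; apply: uP => // j; rewrite leq_eqVlt => /predU1P[Nj|/m0//].
  have -> : j = i by apply: val_inj.
  have [||q ->] := gi_gen m; [by exists v|by move=> ? ?; apply: m0|].
  by rewrite gii mulr0.
have [x xP] := divV (w - \sum_(j | j != i) u j *~ g i j) _ gii.
pose u' j := if j == i then x else u j.
have u'E m : \sum_j u' j *~ m j = x *~ m i + \sum_(j | j != i) u j *~ m j.
  rewrite (bigD1 i) //= /u' eqxx; congr (_ + _).
  by apply: eq_bigr => j /negPf ->.
exists u' => m v Gm m0.
have [||q mq] := gi_gen m; [by exists v|by move=> ? ?; apply: m0|].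
have Gm' : G (m - g i *~ q, v - w *~ q).
  have -> : (m - g i *~ q, v - w *~ q) = (m, v) - (g i, w) *~ q.
    by rewrite [RHS]surjective_pairing /= fst_mulz snd_mulz.
  by case: (sG) => _ GB; apply: GB => //; apply: subgroupMz.
have m'i : (m - g i *~ q) i = 0 by rewrite !ffunE int_ffunMz mq mulrC subrr.
have /(uP _ _ Gm') vE : forall j : 'I_n, (N <= j)%N -> (m - g i *~ q) j = 0.
  move=> j; rewrite leq_eqVlt => /predU1P[Nj|Nj].
    by have -> : j = i by apply: val_inj.
  by rewrite !ffunE int_ffunMz gi0 // m0 // mul0r subr0.
rewrite -[v](subrK (w *~ q)) vE u'E (bigD1 i) //= m'i mulr0z add0r.
rewrite -[w](subrK (\sum_(j | j != i) u j *~ g i j)) -xP mulrzDl addrCA.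
rewrite -!mulrzA mq [q * _]mulrC; congr (_ + _).
rewrite mulrz_suml -big_split /=; apply: eq_bigr => j _.
by rewrite -mulrzA -mulrzDr !ffunE int_ffunMz subrK.
Qed.

End Lattices.

(** * Characters of lattices with values in an algebraically closed field *)

Section MultiplicativeGroup.
Variable F : fieldType.

(** The multiplicative group of a field, written additively so that the theory
   of abelian groups applies to it. *)
Record nonzero := Nonzero { nonzero_val : F; nonzeroP : nonzero_val != 0 }.
HB.instance Definition _ := [isSub for nonzero_val].
HB.instance Definition _ := [Choice of nonzero by <:].

Lemma nonzeroM_subproof (x y : nonzero) : nonzero_val x * nonzero_val y != 0.
Proof. by rewrite mulf_neq0 ?nonzeroP. Qed.
Lemma nonzeroV_subproof (x : nonzero) : (nonzero_val x)^-1 != 0.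
Proof. by rewrite invr_neq0 ?nonzeroP. Qed.

Definition nonzero1 := Nonzero (oner_neq0 F).
Definition nonzeroM x y := Nonzero (nonzeroM_subproof x y).
Definition nonzeroV x := Nonzero (nonzeroV_subproof x).

Lemma nonzeroMA : associative nonzeroM.
Proof. by move=> x y z; apply: val_inj; rewrite /= mulrA. Qed.
Lemma nonzeroMC : commutative nonzeroM.
Proof. by move=> x y; apply: val_inj; rewrite /= mulrC. Qed.
Lemma nonzero1M : left_id nonzero1 nonzeroM.
Proof. by move=> x; apply: val_inj; rewrite /= mul1r. Qed.
Lemma nonzeroVM : left_inverse nonzero1 nonzeroV nonzeroM.
Proof. by move=> x; apply: val_inj; rewrite /= mulVf ?nonzeroP. Qed.

HB.instance Definition _ :=
  GRing.isZmodule.Build nonzero nonzeroMA nonzeroMC nonzero1M nonzeroVM.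

Lemma nonzero_val_mulz (x : nonzero) (z : int) : nonzero_val (x *~ z) = nonzero_val x ^ z.
Proof.
have valMn d : nonzero_val (x *+ d) = nonzero_val x ^+ d.
  by elim: d => [|d IH] //; rewrite mulrS exprS /= IH.
case: z => d; first exact: valMn.
by rewrite {1}NegzE mulrNz -[LHS]/((nonzero_val (x *+ d.+1))^-1) valMn.
Qed.

Lemma nonzero_val_sum (I : finType) (x : I -> nonzero) :
  nonzero_val (\sum_i x i) = \prod_i nonzero_val (x i).
Proof. by apply: (big_morph nonzero_val). Qed.

End MultiplicativeGroup.

Lemma nonzero_divisible (F : closedFieldType) (v : nonzero F) (d : int) :
  d != 0 -> exists w, w *~ d = v.
Proof.
have div_nat (e : nat) (x : nonzero F) : (0 < e)%N -> exists w, w *+ e = x.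
  move=> e_gt0; have /closed_rootP[y] : size ('X^e - (nonzero_val x)%:P) != 1%N.
    by rewrite size_XnsubC //; case: (e) e_gt0.
  rewrite rootE !hornerE subr_eq0 => /eqP yx.
  have y0 : y != 0.
    apply: contraTneq (nonzeroP x) => y0; rewrite -yx y0 expr0n negbK.
    by case: (e) e_gt0.
  exists (Nonzero y0); apply: val_inj => /=.
  by rewrite pmulrn nonzero_val_mulz.
case: d => d d0; first by have [|w wv] := div_nat d v; [lia|exists w].
have [//|w wv] := div_nat d.+1 (- v).
by exists w; rewrite NegzE mulrNz -pmulrn wv opprK.
Qed.

Lemma rat_divisible (v : rat) (d : int) : d != 0 -> exists w, w *~ d = v.
Proof. by move=> d0; exists (v / d%:~R); rewrite -mulrzr divfK ?intr_eq0. Qed.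

Section Characters.
Variable n : nat.
Local Notation Zn := {ffun 'I_n -> int}.
Implicit Types (L : set Zn) (m g : Zn).

Definition zpow (F : fieldType) (v : 'I_n -> F) (m : Zn) : F := \prod_i v i ^ m i.

Lemma character_extension (F : closedFieldType) L (chi : Zn -> F) :
  subgroup L -> (forall m, L m -> chi m != 0) ->
  (forall m m', L m -> L m' -> chi (m + m') = chi m * chi m') ->
  exists2 u : 'I_n -> F, forall i, u i != 0 & forall m, L m -> zpow u m = chi m.
Proof.
move=> sL chi0 chiD.
have chi_0 : chi 0 = 1.
  have L0 : L 0 by case: sL.
  by apply: (mulfI (chi0 _ L0)); rewrite -chiD // addr0 mulr1.
pose G : set (Zn * nonzero F) := [set mv | L mv.1 /\ nonzero_val mv.2 = chi mv.1].
have [|||u uP] := @divisible_extension n _ G.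
- exact: nonzero_divisible.
- split; first by split; [case: sL|rewrite chi_0].
  move=> [m v] [m' v'] [/= Lm vm] [/= Lm' v'm'].
  have LB : L (m - m') by case: sL => _ LB; apply: LB.
  split=> //=; apply: (mulIf (chi0 _ Lm')).
  by rewrite -chiD // subrK vm v'm' divfK // chi0.
- by move=> v [_ /= vE]; apply: val_inj; rewrite /= vE chi_0.
exists (fun i => nonzero_val (u i)) => [i|m Lm]; first exact: nonzeroP.
have /(congr1 (@nonzero_val F)) := uP m (Nonzero (chi0 m Lm)) (conj Lm erefl).
rewrite nonzero_val_sum /= => ->; apply: eq_bigr => i _.
by rewrite nonzero_val_mulz.
Qed.

(** The hypothesis on [z] says that mapping [L] to 0 and [g] to [z] defines a
   homomorphism on the lattice generated by [L] and [g]. *)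
Lemma divisible_separation (V : zmodType) L g (z : V) :
  (forall (v : V) (d : int), d != 0 -> exists w, w *~ d = v) ->
  subgroup L -> (forall e, L (g *~ e) -> z *~ e = 0) ->
  exists2 u : 'I_n -> V, forall m, L m -> \sum_i u i *~ m i = 0
    & \sum_i u i *~ g i = z.
Proof.
move=> divV sL zg.
pose G : set (Zn * V) := [set mv | exists2 e, L (mv.1 - g *~ e) & mv.2 = z *~ e].
have [||u uP] := @divisible_extension n _ G divV.
- split; first by exists 0; rewrite ?mulr0z // subr0; case: sL.
  move=> [m v] [m' v'] [e /= Le ->] [e' /= Le' ->]; exists (e - e') => /=.
    have -> : m - m' - g *~ (e - e') = (m - g *~ e) - (m' - g *~ e').
      by rewrite mulrzBr !opprB addrACA [in RHS]addrACA [- m' + _]addrC.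
    by case: sL => _ LB; apply: LB.
  by rewrite mulrzBr.
- move=> v [e /= Le ->]; apply: zg; rewrite -[_ *~ _]opprK -[- (_ *~ _)]add0r.
  exact: subgroupN.
exists u => [m Lm|]; symmetry.
  by apply: uP; exists 0; rewrite mulr0z ?subr0.
by apply: uP; exists 1; rewrite mulr1z // subrr; case: sL.
Qed.

(** A vector outside a lattice is detected by a character of the quotient: in
   characteristic 0 there are roots of unity of every order. *)
Lemma character_separation (F : closedFieldType) L g :
  [pchar F] =i pred0 -> subgroup L -> ~ L g ->
  exists u : 'I_n -> F, [/\ forall i, u i != 0,
    forall m, L m -> zpow u m = 1 & zpow u g != 1].
Proof.
move=> /pcharf0P charF sL nLg.
suff [z [z1 zg]] : exists z : nonzero F, nonzero_val z != 1 /\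
    forall e, L (g *~ e) -> nonzero_val z ^ e = 1.
  have [|u uL ug] := @divisible_separation _ L g z (@nonzero_divisible F) sL.
    by move=> e /zg ze; apply: val_inj; rewrite /= nonzero_val_mulz.
  have uE m : zpow (fun i => nonzero_val (u i)) m = nonzero_val (\sum_i u i *~ m i).
    by rewrite nonzero_val_sum; apply: eq_bigr => i _; rewrite nonzero_val_mulz.
  exists (fun i => nonzero_val (u i)); split=> [i|m Lm|]; first exact: nonzeroP.
    by rewrite uE uL.
  by rewrite uE ug.
have [|d Ld d_gen] := @int_subgroup_principal [set e | L (g *~ e)].
  split=> [|a b La Lb /=]; first by rewrite /= mulr0z; case: sL.
  by rewrite mulrzBr; case: sL => _ LB; apply: LB.
(* Here [g] has infinite order modulo [L]: any value but 0 and 1 will do. *)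
have [d0|d0] := eqVneq d 0.
  have two0 : 2%:R != 0 :> F by rewrite charF.
  exists (Nonzero two0); split=> [/=|e /d_gen[q ->]].
    by rewrite -subr_eq0 (_ : 2%:R - 1 = 1 :> F) ?oner_neq0 // mulrSr addrK.
  by rewrite d0 mulr0.
pose N := `|d|%N.
have N1 : N != 1%N.
  apply/eqP => N1; apply: nLg; have : d = 1 \/ d = -1 by rewrite /N in N1; lia.
  case=> dE; rewrite dE in Ld; first by rewrite /= mulr1z in Ld.
  by rewrite -[g]opprK -[- g]mulrN1z; apply: subgroupN.
have N0 : (0 < N)%N by rewrite absz_gt0.
(* A root of [1 + X + ... + X ^ (N - 1)] is an [N]-th root of unity, and is
   not 1 because [N] is nonzero in [F]. *)
have /closed_rootP[z] : size (\poly_(i < N) (1 : F)) != 1%N.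
  by rewrite size_poly_eq ?oner_neq0.
rewrite rootE horner_poly => /eqP zN.
have zN1 : z ^+ N = 1.
  apply/eqP; rewrite -subr_eq0 subrX1; apply/eqP.
  by rewrite (eq_bigr (fun i : 'I_N => 1 * z ^+ i)) ?zN ?mulr0 // => i _; rewrite mul1r.
have z0 : z != 0.
  by apply: contraTneq (oner_neq0 F) => z0; rewrite -zN1 z0 expr0n negbK; case: (N) N0.
exists (Nonzero z0); split=> /= [|e /d_gen[q ->]].
  apply: contraNneq (isT : ~~ false) => z1; move/eqP: zN; rewrite z1.
  rewrite (eq_bigr (fun=> 1)) => [|i _]; last by rewrite expr1n mulr1.
  by rewrite sumr_const card_ord charF; case: (N) N0.
rewrite mulrC -exprz_exp (_ : z ^ d = 1) ?exp1rz //.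
have : d = N%:Z \/ d = - N%:Z by rewrite /N; lia.
by case=> ->; rewrite -?exprnN -?exprnP zN1 ?invr1.
Qed.

End Characters.

(** * Linear forms separating the cosets of a saturated lattice *)

Section SaturatedLattices.
Variable n : nat.
Local Notation Zn := {ffun 'I_n -> int}.
Implicit Types (L : set Zn) (m g : Zn).

Definition int_pairing (w : 'I_n -> int) m : int := \sum_i w i * m i.

(** Modulo a saturated lattice [g] has infinite order, so some homomorphism to
   the rationals that kills [L] maps [g] to 1; then clear denominators. *)
Lemma saturated_separation L g : subgroup L -> Sat L `<=` L -> ~ L g ->
  exists2 w, forall m, L m -> int_pairing w m = 0 & int_pairing w g != 0.
Proof.
move=> sL satL nLg.
have [|u uL ug] := @divisible_separation n _ L g 1 rat_divisible sL.
  move=> e Le; have [->|e0] := eqVneq e 0; first by rewrite mulr0z.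
  by case: nLg; apply: satL; exists e.
pose D := \prod_i denq (u i).
have D0 : D != 0 by apply/prodf_neq0 => i _; apply: denq_neq0.
pose w i := numq (u i) * \prod_(j | j != i) denq (u j).
have wE m : (int_pairing w m)%:~R = (\sum_i u i *~ m i) * D%:~R.
  rewrite mulr_suml rmorph_sum /=; apply: eq_bigr => i _.
  rewrite -[in RHS](divq_num_den (u i)) /D (bigD1 i) //= !rmorphM /= -mulrzr.
  by field; rewrite intr_eq0 denq_neq0.
exists w => [m Lm|]; first by apply/eqP; rewrite -(intr_eq0 rat) wE uL // mul0r.
by rewrite -(intr_eq0 rat) wE ug mul1r intr_eq0.
Qed.

(** If [w1] is nonzero on a finite set, adding a large multiple of [w1] to
   [w2] keeps these values nonzero, and the values of [w2] on the zeros of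
   [w1]. *)
Lemma saturated_separation_seq L (s : seq Zn) : subgroup L -> Sat L `<=` L ->
  (forall g, g \in s -> ~ L g) ->
  exists2 w, forall m, L m -> int_pairing w m = 0 &
    forall g, g \in s -> int_pairing w g != 0.
Proof.
move=> sL satL; elim: s => [_|g s IH nL].
  by exists (fun=> 0) => // m _; apply: big1 => i _; rewrite mul0r.
have [|w1 w1L w1s] := IH; first by move=> h hs; apply: nL; rewrite inE hs orbT.
have [w2 w2L w2g] := saturated_separation sL satL (nL g (mem_head _ _)).
pose N := (\sum_(h <- g :: s) `|int_pairing w2 h|).+1.
pose w i := w1 i * N%:Z + w2 i.
have wE m : int_pairing w m = int_pairing w1 m * N%:Z + int_pairing w2 m.
  rewrite /int_pairing mulr_suml -big_split; apply: eq_bigr => i _ /=.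
  by rewrite /w; ring.
exists w => [m Lm|h hs]; first by rewrite wE w1L // w2L // mul0r addr0.
rewrite wE; have [w10|w10] := eqVneq (int_pairing w1 h) 0.
  rewrite w10 mul0r add0r; move: hs; rewrite inE => /predU1P[->//|/w1s].
  by rewrite w10.
have : (`|int_pairing w2 h| < N)%N.
  by rewrite ltnS (big_rem h) //= leq_addr.
move: w10; set a := int_pairing w1 h; set b := int_pairing w2 h => a0 bN.
apply: contraTneq bN => ab; rewrite -leqNgt.
have -> : b = - (a * N%:Z) by lia.
by rewrite abszN abszM absz_nat leq_pmull // absz_gt0.
Qed.

End SaturatedLattices.

(** * Torus points and lattice ideals *)

Section TorusPoints.
Variables (F : fieldType) (n : nat) (E : {set 'I_n}).
Local Notation Zn := {ffun 'I_n -> int}.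
Implicit Types (a b c : 'X_{1..n}).

Definition supported_on a := forall i, i \notin E -> a i = 0%N.

Definition mnm_diff a b : Zn := [ffun i => (a i)%:Z - (b i)%:Z].

Lemma pos_neg_part (m : Zn) : mnm_diff (pos_part m) (neg_part m) = m.
Proof.
apply/ffunP => i; rewrite ffunE !mnmE.
by move: (m i) => z; case: (leP z 0) => h; case: (leP (- z) 0) => h'; lia.
Qed.

Lemma mnm_diff_gcd a b : exists c,
  [/\ a = (c + pos_part (mnm_diff a b))%MM, b = (c + neg_part (mnm_diff a b))%MM
    & forall i, (c i <= a i)%N].
Proof.
exists [multinom minn (a i) (b i) | i < n].
split; last by move=> i; rewrite mnmE geq_minl.
  apply/mnmP => i; rewrite mnmDE !mnmE ffunE.
  by move: (a i) (b i) => x y; case: (leP (x%:Z - y%:Z) 0) => h; lia.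
apply/mnmP => i; rewrite mnmDE !mnmE ffunE.
by move: (a i) (b i) => x y; case: (leP (- (x%:Z - y%:Z)) 0) => h; lia.
Qed.

Lemma supported_pos_part (m : Zn) :
  (forall i, i \notin E -> m i = 0) -> supported_on (pos_part m).
Proof. by move=> mE i /mE mi; rewrite mnmE mi. Qed.

Lemma supported_neg_part (m : Zn) :
  (forall i, i \notin E -> m i = 0) -> supported_on (neg_part m).
Proof. by move=> mE i /mE mi; rewrite mnmE mi. Qed.

Lemma mevalX_neq0 (v : 'I_n -> F) a : (forall i, i \in E -> v i != 0) ->
  supported_on a -> ('X_[a] : {mpoly F[n]}).@[v] != 0.
Proof.
move=> v0 aE; rewrite mevalX; apply/prodf_neq0 => i _.
have [/v0 vi|/aE->] := boolP (i \in E); [exact: expf_neq0|exact: oner_neq0].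
Qed.

Lemma zpow_diff (v : 'I_n -> F) a b : (forall i, i \in E -> v i != 0) ->
  supported_on a -> supported_on b ->
  ('X_[a] : {mpoly F[n]}).@[v] = zpow v (mnm_diff a b) * ('X_[b] : {mpoly F[n]}).@[v].
Proof.
move=> v0 aE bE; rewrite !mevalX -big_split /=; apply: eq_bigr => i _.
have [/v0 vi|iE] := boolP (i \in E); last by rewrite ffunE aE // bE // mulr1.
by rewrite ffunE !exprnP -expfzDr // subrK.
Qed.

Lemma zpowM (v w : 'I_n -> F) (m : Zn) :
  zpow (fun i => v i * w i) m = zpow v m * zpow w m.
Proof. by rewrite -big_split; apply: eq_bigr => i _; rewrite /= expfzMl. Qed.

Lemma mevalXM (v w : 'I_n -> F) a : ('X_[a] : {mpoly F[n]}).@[fun i => v i * w i] =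
  ('X_[a] : {mpoly F[n]}).@[v] * ('X_[a] : {mpoly F[n]}).@[w].
Proof. by rewrite !mevalX -big_split; apply: eq_bigr => i _; rewrite /= exprMn. Qed.

Lemma zpow_restrict (v : 'I_n -> F) (m : Zn) : (forall i, i \notin E -> m i = 0) ->
  zpow (fun i => if i \in E then v i else 0) m = zpow v m.
Proof.
move=> mE; apply: eq_bigr => i _; case: ifPn => // /mE ->.
by rewrite !expr0z.
Qed.

End TorusPoints.

Section LatticeIdeals.
Variables (F : fieldType) (Omega : closedFieldType) (f : {rmorphism F -> Omega}).
Variables (n : nat) (E : {set 'I_n}) (sigma : partial_character F E).
Hypothesis char_Omega : [pchar Omega] =i pred0.
Local Notation Zn := {ffun 'I_n -> int}.
Local Notation R := {mpoly F[n]}.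
Local Notation L := (pc_lat sigma).
Implicit Types (a b c : 'X_{1..n}) (p q : R) (v : 'I_n -> Omega).

Lemma pc_subgroup : subgroup L.
Proof. by split; [exact: pc_lat0|exact: pc_latB]. Qed.

(** The points, over an algebraically closed field, of the variety of the
   ideal of a partial character that lie in the torus of the cell. *)
Definition torus_point v : Prop :=
  (forall i, (v i != 0) = (i \in E)) /\
  forall m, L m -> zpow v m = f (pc_val sigma m).

Lemma torus_point_exists : exists v, torus_point v.
Proof.
have [||u u0 uL] := @character_extension n Omega L (fun m => f (pc_val sigma m)) pc_subgroup.
- by move=> m Lm; rewrite fmorph_eq0; apply: pc_val_neq0 Lm.
- by move=> m m' Lm Lm'; rewrite (pc_valD Lm Lm') rmorphM.
exists (fun i => if i \in E then u i else 0); split=> [i|m Lm].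
  by case: ifP => _; rewrite ?u0 ?eqxx.
by rewrite zpow_restrict ?uL //; apply: pc_supp Lm.
Qed.

Lemma torus_point_neq0 v i : torus_point v -> i \in E -> v i != 0.
Proof. by move=> [-> _]. Qed.

Lemma torus_pointM v w : torus_point v -> (forall i, w i != 0) ->
  (forall m, L m -> zpow w m = 1) -> torus_point (fun i => v i * w i).
Proof.
move=> [v0 vL] w0 wL; split=> [i|m Lm]; first by rewrite mulf_eq0 negb_or w0 andbT v0.
by rewrite zpowM vL // wL // mulr1.
Qed.

Lemma vanishing_is_ideal v : is_ideal [set p : R | (map_mpoly f p).@[v] = 0].
Proof.
split; first by rewrite /= !raddf0.
  by move=> p q /= p0 q0; rewrite !raddfD /= p0 q0 addr0.
by move=> p q /= q0; rewrite rmorphM /= mevalM q0 mulr0.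
Qed.

Lemma ideal_M_is_ideal : is_ideal (ideal_M (F := F) E).
Proof. exact: ideal_span_is_ideal. Qed.

Lemma ideal_P_is_ideal : is_ideal (ideal_P sigma).
Proof. exact: ideal_add_is_ideal ideal_M_is_ideal (ideal_span_is_ideal _). Qed.

Lemma ideal_M_monomial a : ~ supported_on E a -> ideal_M E ('X_[a] : R).
Proof.
move/existsNP=> [i /not_implyP[iE /eqP ai]].
rewrite -(submK (_ : U_(i)%MM <= a)%MM) ?mpolyXD; last by rewrite lep1mP.
by apply: is_idealM; [exact: ideal_M_is_ideal|apply: ideal_span_gen; exists i].
Qed.

Lemma lattice_ideal_binomial a b : supported_on E a -> L (mnm_diff a b) ->
  lattice_ideal sigma ('X_[a] - pc_val sigma (mnm_diff a b) *: 'X_[b]).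
Proof.
move=> aE Lab; have [c [ac bc ca]] := mnm_diff_gcd a b.
have aX : 'X_[a] = 'X_[c] * 'X_[pos_part (mnm_diff a b)] :> R.
  by rewrite -mpolyXD -ac.
have bX : 'X_[b] = 'X_[c] * 'X_[neg_part (mnm_diff a b)] :> R.
  by rewrite -mpolyXD -bc.
rewrite aX bX scalerAr -mulrBr; apply: ideal_span_in_gen.
  move=> m; rewrite msuppX inE => /eqP-> i /aE ai.
  by apply/eqP; rewrite -leqn0 -ai.
by exists (mnm_diff a b).
Qed.

Lemma lattice_ideal_gen (m : Zn) : L m ->
  lattice_ideal sigma ('X_[pos_part m] - pc_val sigma m *: 'X_[neg_part m]).
Proof.
move=> Lm; rewrite -{2}(pos_neg_part m); apply: lattice_ideal_binomial.
  exact/supported_pos_part/pc_supp/Lm.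
by rewrite pos_neg_part.
Qed.

Lemma lattice_ideal_sub_P : lattice_ideal sigma `<=` ideal_P sigma.
Proof.
move=> p sp; apply: ideal_addr; first exact: ideal_M_is_ideal.
exact: ideal_span_gen.
Qed.

Lemma ideal_M_sub_P : ideal_M E `<=` ideal_P sigma.
Proof. by apply: ideal_addl; apply: ideal_span_is_ideal. Qed.

Lemma ideal_M_vanish v : (forall i, i \notin E -> v i = 0) ->
  ideal_M E `<=` [set p : R | (map_mpoly f p).@[v] = 0].
Proof.
move=> v0; apply: ideal_span_sub; first exact: vanishing_is_ideal.
by move=> _ [i iE ->]; rewrite /= map_mpolyX mevalXU v0.
Qed.

Lemma lattice_ideal_vanish v : torus_point v ->
  lattice_ideal sigma `<=` [set p : R | (map_mpoly f p).@[v] = 0].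
Proof.
move=> vT; apply: ideal_span_in_sub; first exact: vanishing_is_ideal.
move=> _ [m Lm ->] /=; have mE := pc_supp Lm.
rewrite raddfB /= map_mpolyZ !map_mpolyX mevalB mevalZ.
rewrite (@zpow_diff _ _ E v _ (neg_part m)) ?pos_neg_part.
- by case: vT => _ ->; rewrite ?subrr.
- by move=> i; apply: torus_point_neq0.
- exact: supported_pos_part.
- exact: supported_neg_part.
Qed.

Lemma torus_point_eq0 v i : torus_point v -> i \notin E -> v i = 0.
Proof. by move=> [v0 _] iE; apply/eqP; rewrite -[_ == _]negbK v0. Qed.

Lemma ideal_P_vanish v : torus_point v -> ideal_P sigma `<=` [set p : R | (map_mpoly f p).@[v] = 0].
Proof.
move=> vT; have Iid := vanishing_is_ideal v.
apply: ideal_add_sub => //; last by apply: ideal_span_sub => //; apply: lattice_ideal_vanish.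
by apply: ideal_M_vanish => i; apply: torus_point_eq0.
Qed.

(** Normal forms modulo [ideal_P sigma]: one monomial for each coset of the
   lattice. *)
Definition reduced p : Prop :=
  (forall a, a \in msupp p -> supported_on E a) /\
  forall a b, a \in msupp p -> b \in msupp p -> L (mnm_diff a b) -> a = b.

Lemma reduction p : exists2 q, ideal_P sigma (p - q) & reduced q.
Proof.
have Pid := ideal_P_is_ideal.
move: {2}(size _) (leqnn (size (msupp p))) => N.
elim: N p => [|N IH] p pN.
  exists p; first by rewrite subrr; apply: is_ideal0.
  by rewrite /reduced; move: pN; rewrite leqn0 size_eq0 => /eqP->.
(* Subtracting [r] removes the monomial [a] without creating new ones. *)
have step r a : ideal_P sigma r -> a \in msupp p -> r@_a = p@_a ->
    (forall b, b \in msupp r -> b \in msupp p) ->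
    exists2 q, ideal_P sigma (p - q) & reduced q.
  move=> Pr ap ra rp; have [|q Pq qr] := IH (p - r).
    rewrite -ltnS; apply: leq_trans pN.
    apply: (@leq_trans (size (rem a (msupp p))).+1); last first.
      by rewrite size_rem // prednK //; case: (msupp p) ap.
    rewrite ltnS; apply: uniq_leq_size => // b bpr.
    rewrite mem_rem_uniq ?inE // -topredE /=; apply/andP; split.
      by apply: contraTneq bpr => ->; rewrite -mcoeff_eq0 mcoeffB ra subrr.
    by move/msuppB_le: bpr; rewrite mem_cat => /orP[//|/rp].
  exists q => //; rewrite -[p](subrK r) -addrA [r - q]addrC addrA.
  exact: is_idealD.
have [[a ap naE]|allE] := pselect (exists2 a, a \in msupp p & ~ supported_on E a).
  apply: (step (p@_a *: 'X_[a]) a) => //.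
  - by apply: is_idealZ => //; apply: ideal_M_sub_P; apply: ideal_M_monomial.
  - by rewrite mcoeffZ mcoeffX eqxx mulr1.
  - by move=> b /msuppZ_le; rewrite msuppX inE => /eqP->.
have {}allE a : a \in msupp p -> supported_on E a.
  by move=> ap; apply: contrapT => naE; apply: allE; exists a.
have [[a [b [ap bp Lab ab]]]|allL] := pselect
  (exists a b, [/\ a \in msupp p, b \in msupp p, L (mnm_diff a b) & a <> b]).
  pose r := 'X_[a] - pc_val sigma (mnm_diff a b) *: 'X_[b].
  apply: (step (p@_a *: r) a) => //.
  - apply: is_idealZ => //; apply: lattice_ideal_sub_P.
    by apply: lattice_ideal_binomial => //; apply: allE.
  - rewrite mcoeffZ mcoeffB mcoeffZ !mcoeffX eqxx.
    have /negPf-> : b != a by apply/eqP => ba; apply: ab.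
    by rewrite mulr0 subr0 mulr1.
  - move=> c /msuppZ_le /msuppB_le; rewrite mem_cat msuppX inE => /orP[/eqP->//|].
    by move=> /msuppZ_le; rewrite msuppX inE => /eqP->.
exists p; first by rewrite subrr; apply: is_ideal0.
split=> // a b ap bp Lab; apply: contrapT => ab; apply: allL.
by exists a, b; split.
Qed.

(** Independence of characters, with the roles of group elements and
   characters exchanged: translating by a character which separates two
   monomials cancels one of the terms of a linear relation. *)
Lemma torus_independence (s : seq 'X_{1..n}) (c : 'X_{1..n} -> Omega) :
  uniq s -> (forall a, a \in s -> supported_on E a) ->
  (forall a b, a \in s -> b \in s -> L (mnm_diff a b) -> a = b) ->
  (forall v, torus_point v -> \sum_(a <- s) c a * 'X_[a].@[v] = 0) ->
  forall a, a \in s -> c a = 0.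
Proof.
elim: s c => [|a0 s IH] c //= /andP[a0s us] sE sL c0.
have sE' a : a \in s -> supported_on E a by move=> h; apply: sE; rewrite inE h orbT.
have cs b : b \in s -> c b = 0.
  move=> bs.
  have nL : ~ L (mnm_diff b a0).
    by move/sL => ba0; rewrite -ba0 ?inE ?eqxx ?bs ?orbT // in a0s.
  have [u [u0 uL ub]] := character_separation char_Omega pc_subgroup nL.
  pose c' a := c a * ('X_[a].@[u] - 'X_[a0].@[u]).
  have : c' b = 0.
    apply: (IH c') => // [a a' ha ha'|v vT].
      by apply: sL; rewrite inE ?ha ?ha' orbT.
    have E1 := c0 _ vT; have E2 := c0 _ (torus_pointM vT u0 uL).
    rewrite big_cons in E1; rewrite big_cons mevalXM in E2.
    have {E1 E2} := congr2 (fun x y => x - 'X_[a0].@[u] * y) E2 E1.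
    rewrite /= mulr0 subr0 mulrDr opprD addrACA.
    rewrite [X in _ + (_ - X)]mulr_sumr -sumrB.
    rewrite (_ : c a0 * _ - _ = 0); last by ring.
    rewrite add0r => E3; rewrite -[RHS]E3; apply: eq_bigr => a _; rewrite mevalXM /c'; ring.
  move/eqP; rewrite mulf_eq0 => /orP[/eqP//|]; rewrite subr_eq0 => /eqP e.
  case/eqP: ub; apply: (@mulIf _ ('X_[a0].@[u])).
    by apply: (@mevalX_neq0 _ _ E) => //; apply: sE; apply: mem_head.
  rewrite mul1r -(@zpow_diff _ _ E) //; first exact: sE'.
  by apply: sE; apply: mem_head.
move=> a; rewrite inE => /predU1P[->|/cs//].
have [v vT] := torus_point_exists; have := c0 v vT.
rewrite big_cons big1_seq ?addr0 => [/eqP|b /andP[_ /cs->]]; last by rewrite mul0r.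
have Xv : 'X_[a0].@[v] != 0.
  apply: (@mevalX_neq0 _ _ E); last by apply: sE; apply: mem_head.
  by move=> i; apply: torus_point_neq0.
by rewrite mulf_eq0 (negPf Xv) orbF => /eqP.
Qed.

Lemma meval_msupp p v : (map_mpoly f p).@[v] = \sum_(a <- msupp p) f p@_a * 'X_[a].@[v].
Proof.
rewrite {1}[p]mpolyE (raddf_sum (map_mpoly f)) (raddf_sum (meval v)).
apply: eq_bigr => a _ /=.
by rewrite map_mpolyZ map_mpolyX mevalZ.
Qed.

Lemma reduced_vanish0 p : reduced p ->
  (forall v, torus_point v -> (map_mpoly f p).@[v] = 0) -> p = 0.
Proof.
move=> [pE pL] p0; apply/eqP/contraT; rewrite -msupp_eq0.
case: (msupp p) (msupp_uniq p) pE pL (meval_msupp p) (@mcoeff_msupp _ _ p) => //.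
move=> a s us pE pL pM pc _.
have /eqP : f p@_a = 0.
  apply: (torus_independence us pE pL (c := fun a => f p@_a) _ (mem_head a s)).
  by move=> v vT; rewrite -pM p0.
by rewrite fmorph_eq0; apply: contraLR => _; rewrite -pc mem_head.
Qed.

(** The Nullstellensatz for lattice ideals: modulo [ideal_P sigma] every
   polynomial has a normal form, and the coefficients of a normal form can be
   read off from its values at the torus points. *)
Theorem lattice_nullstellensatz p :
  ideal_P sigma p <-> forall v, torus_point v -> (map_mpoly f p).@[v] = 0.
Proof.
split=> [Pp v vT|p0]; first exact: ideal_P_vanish vT p Pp.
have [q Ppq qr] := reduction p.
suff q0 : q = 0 by rewrite q0 subr0 in Ppq.
apply: reduced_vanish0 => // v vT.
have := ideal_P_vanish vT Ppq; rewrite /= rmorphB mevalB p0 // => /eqP.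
by rewrite sub0r oppr_eq0 => /eqP.
Qed.

Lemma ideal_P_radical p d : ideal_P sigma (p ^+ d) -> ideal_P sigma p.
Proof.
move=> /lattice_nullstellensatz pd; apply/lattice_nullstellensatz => v /pd.
by rewrite !rmorphXn /= => /eqP; rewrite expf_eq0 => /andP[_ /eqP].
Qed.

Lemma ideal_P_proper : is_proper (ideal_P sigma).
Proof.
have [v vT] := torus_point_exists.
by move/lattice_nullstellensatz/(_ v vT)/eqP; rewrite rmorph1 meval1 oner_eq0.
Qed.

(** On a curve [t |-> (v i * t ^ w i)] whose weights [w] vanish on the lattice
   and separate its cosets, a reduced polynomial restricts to a nonzero
   Laurent polynomial in [t], which the factor [t ^ N] makes a polynomial. *)
Lemma reduced_on_curve q v (w : 'I_n -> int) : reduced q -> q != 0 ->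
  torus_point v ->
  (forall a b, a \in msupp q -> b \in msupp q ->
     int_pairing w (mnm_diff a b) = 0 -> a = b) ->
  exists N (h : {poly Omega}), h != 0 /\ forall t, t != 0 ->
    h.[t] = t ^+ N * (map_mpoly f q).@[fun i => v i * t ^ w i].
Proof.
move=> [qE _] q0 vT w_sep.
pose wt a : int := \sum_i w i * (a i)%:Z.
have wt_diff a b : int_pairing w (mnm_diff a b) = wt a - wt b.
  rewrite /int_pairing /wt -sumrB; apply: eq_bigr => i _; rewrite ffunE; ring.
pose N := (\sum_(a <- msupp q) `|wt a|)%N.
have wtN a : a \in msupp q -> (`|wt a| <= N)%N.
  by move=> aq; rewrite /N (big_rem a) //= leq_addr.
pose e a := `|(wt a + N%:Z)%R|%N.
have eE a : a \in msupp q -> (e a)%:Z = wt a + N%:Z.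
  by move=> /wtN; rewrite /e; lia.
pose co a := f q@_a * 'X_[a].@[v].
exists N, (\sum_(a <- msupp q) co a *: 'X^(e a)); split=> [|t t0].
  have : msupp q != [::] by rewrite msupp_eq0.
  case E0 : (msupp q) => [//|a s] _; rewrite -E0.
  have aq : a \in msupp q by rewrite E0 mem_head.
  apply/eqP => /(congr1 (fun h : {poly Omega} => h`_(e a))).
  rewrite coef0 coef_sum (bigD1_seq a) ?msupp_uniq //= coefZ coefXn eqxx mulr1.
  rewrite big1_seq => [|b /andP[ba bq]]; last first.
    rewrite coefZ coefXn; case: eqP; rewrite ?mulr0 // => eab.
    case/eqP: ba; symmetry; apply: w_sep => //; rewrite wt_diff; apply/eqP.
    by have := eE a aq; have := eE b bq; rewrite eab; lia.
  move/eqP; rewrite addr0 mulf_eq0 fmorph_eq0; apply/negP; rewrite negb_or.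
  rewrite -mcoeff_msupp aq /=; apply: (@mevalX_neq0 _ _ E); last exact: qE.
  by move=> i; apply: torus_point_neq0.
rewrite horner_sum meval_msupp mulr_sumr; apply: eq_big_seq => a aq.
have te : t ^+ e a = t ^+ N * 'X_[a].@[fun i => t ^ w i].
  rewrite [LHS]exprnP eE // expfzDr // mulrC; congr (_ * _).
  rewrite mevalX /wt (big_morph _ (fun x y => expfzDr x y t0) (expr0z t)).
  by apply: eq_bigr => i _; rewrite exprnP exprz_exp.
by rewrite hornerZ hornerXn mevalXM te /co mulrCA -!mulrA.
Qed.

(** The ideal of a character of a saturated lattice is prime: if reduced [p]
   and [q] are nonzero then so are their restrictions to a suitable curve
   through a torus point, and some point of the curve is a zero of neither. *)
Theorem saturated_ideal_P_prime : Sat L `<=` L -> prime_ideal (ideal_P sigma).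
Proof.
move=> satL; have Pid := ideal_P_is_ideal.
split=> //; first exact: ideal_P_proper.
move=> p1 q1 Ppq.
have [p Pp pr] := reduction p1; have [q Pq qr] := reduction q1.
have {}Ppq : ideal_P sigma (p * q).
  have -> : p * q = p1 * q1 - ((p1 - p) * q1 + p * (q1 - q)) by ring.
  apply: is_idealB => //; apply: is_idealD => //; last exact: is_idealM.
  exact: is_idealMr.
have [p0|p0] := eqVneq p 0; first by left; rewrite -[p1]subr0 -p0.
have [q0|q0] := eqVneq q 0; first by right; rewrite -[q1]subr0 -q0.
exfalso.
have [v vT] := torus_point_exists.
pose diffs := [seq d <- [seq mnm_diff a b | a <- msupp p ++ msupp q,
  b <- msupp p ++ msupp q] | `[< ~ L d >]].
have [|w wL w_sep] := @saturated_separation_seq n L diffs pc_subgroup satL.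
  by move=> d; rewrite mem_filter => /andP[/asboolP].
have sep (r : R) : reduced r -> {subset msupp r <= msupp p ++ msupp q} ->
    forall a b, a \in msupp r -> b \in msupp r ->
    int_pairing w (mnm_diff a b) = 0 -> a = b.
  move=> [_ rL] rs a b ar br wab; apply: rL => //; apply: contrapT => nL.
  have /w_sep : mnm_diff a b \in diffs.
    by rewrite mem_filter (asboolT nL) /=; apply: allpairs_f; apply: rs.
  by rewrite wab.
have [|N [h [h0 hE]]] := reduced_on_curve pr p0 vT (w := w).
  by apply: sep => // a; rewrite mem_cat => ->.
have [|M [g [g0 gE]]] := reduced_on_curve qr q0 vT (w := w).
  by apply: sep => // a; rewrite mem_cat => ->; rewrite orbT.
have /closed_nonrootP[t] : h * g * 'X != 0 by rewrite !mulf_neq0 ?polyX_eq0.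
rewrite !rootM !negb_or rootX => /andP[/andP[ht gt] t0].
have tT : torus_point (fun i => v i * t ^ w i).
  apply: torus_pointM => // [i|m Lm]; first exact: expfz_neq0.
  rewrite /zpow -[RHS](expr0z t) -(wL m Lm) /int_pairing.
  rewrite (big_morph _ (fun x y => expfzDr x y t0) (expr0z t)).
  by apply: eq_bigr => i _; rewrite exprz_exp.
have /lattice_nullstellensatz/(_ _ tT)/eqP := Ppq.
rewrite rmorphM mevalM mulf_eq0; apply/negP; rewrite negb_or.
move: ht gt; rewrite !rootE hE // gE // !mulf_eq0 !negb_or.
by move=> /andP[_ ->] /andP[_ ->].
Qed.

End LatticeIdeals.

(** * Cellular binomial ideals *)

Section CellularIdeals.
Variables (F : fieldType) (n : nat) (E : {set 'I_n}).
Local Notation R := {mpoly F[n]}.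
Local Notation Zn := {ffun 'I_n -> int}.
Local Notation supported_on := (supported_on E).
Implicit Types (a b c : 'X_{1..n}) (p q : R) (x y z : F).

Lemma subring_inX a : supported_on a -> subring_in E ('X_[a] : R).
Proof. by move=> aE m; rewrite msuppX inE => /eqP->. Qed.

Lemma subring_inD p q : subring_in E p -> subring_in E q -> subring_in E (p + q).
Proof. by move=> pE qE m /msuppD_le; rewrite mem_cat => /orP[/pE|/qE]. Qed.

Lemma subring_inM p q : subring_in E p -> subring_in E q -> subring_in E (p * q).
Proof.
move=> pE qE m /msuppM_le/allpairsP[[a b] /= [/pE aE /qE bE ->]] i iE.
by rewrite mnmDE aE // bE.
Qed.

Lemma subring_inZ x p : subring_in E p -> subring_in E (x *: p).
Proof. by move=> pE m /msuppZ_le/pE. Qed.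

Lemma subring_in0 : subring_in E (0 : R).
Proof. by move=> m; rewrite msupp0. Qed.

Lemma lattice_idealZ (sigma : partial_character F E) x p :
  lattice_ideal sigma p -> lattice_ideal sigma (x *: p).
Proof.
move=> [r [a [g [aE Gg ->]]]]; exists r, (fun j => x *: a j), g; split=> //.
  by move=> j; apply: subring_inZ.
by rewrite scaler_sumr; apply: eq_bigr => j _; rewrite scalerAl.
Qed.

Lemma lattice_ideal_sub_subring (sigma : partial_character F E) :
  lattice_ideal sigma `<=` subring_in E.
Proof.
move=> _ [r [a [g [aE Gg ->]]]].
apply: (big_ind (subring_in E)); [exact: subring_in0|exact: subring_inD|].
move=> j _; apply: subring_inM => //; have [m Lm ->] := Gg j.
apply: subring_inD; first exact/subring_inX/supported_pos_part/pc_supp/Lm.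
rewrite -scaleNr; apply/subring_inZ/subring_inX/supported_neg_part.
exact: pc_supp Lm.
Qed.

Variable J : set R.
Hypotheses (J_binomial : binomial_ideal J) (J_cellular : cellular J).
Hypothesis J_cell : cell_indices J E.

Let J_ideal : is_ideal J := binomial_ideal_is_ideal J_binomial.

Lemma cell_monomial_cancel a p : supported_on a -> J ('X_[a] * p) -> J p.
Proof.
move=> aE; suff : nonzerodivisor_mod J 'X_[a] by apply.
rewrite mpolyXE_id; apply: (big_ind (nonzerodivisor_mod J)).
- by move=> q; rewrite mul1r.
- by move=> q r nq nr s; rewrite -mulrA => /nq/nr.
- move=> i _ q; have [iE|iE] := boolP (i \in E).
    by apply: nonzerodivisor_modX; apply/J_cell.
  by rewrite aE // mul1r.
Qed.

Lemma cell_no_monomial a : supported_on a -> ~ J 'X_[a].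
Proof.
by move=> aE Ja; case: J_cellular => J1 _; apply/J1/(cell_monomial_cancel aE); rewrite mulr1.
Qed.

(** As the variables of the cell can be cancelled, membership of a binomial in
   [J] only depends on its ratio of coefficients and on the difference of its
   exponents. *)
Lemma cell_binomial_diff a b a' b' x : supported_on a -> supported_on b ->
  mnm_diff a b = mnm_diff a' b' ->
  J ('X_[a] - x *: 'X_[b]) -> supported_on b' -> J ('X_[a'] - x *: 'X_[b']).
Proof.
move=> aE bE ab Jab b'E; apply: (cell_monomial_cancel bE).
have eq_ab : (b + a' = b' + a)%MM.
  apply/mnmP => i; rewrite !mnmDE.
  have /= := congr1 (fun m : Zn => m i) ab; rewrite !ffunE.
  by move: (a i) (b i) (a' i) (b' i) => *; lia.
have -> : 'X_[b] * ('X_[a'] - x *: 'X_[b']) = 'X_[b'] * ('X_[a] - x *: 'X_[b]) :> R.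
  by rewrite !mulrBr -!scalerAr -!mpolyXD eq_ab [(b + b')%MM]addmC.
exact: is_idealM.
Qed.

Lemma cell_binomial_uniq a b x y : supported_on b ->
  J ('X_[a] - x *: 'X_[b]) -> J ('X_[a] - y *: 'X_[b]) -> x = y.
Proof.
move=> bE Jx Jy; apply/eqP; rewrite -subr_eq0; apply/negPn/negP => xy.
apply: (cell_no_monomial bE).
rewrite -['X_[b]]scale1r -(mulVf xy) -scalerA; apply: is_idealZ => //.
have -> : (x - y) *: 'X_[b] = ('X_[a] - y *: 'X_[b]) - ('X_[a] - x *: 'X_[b]) :> R.
  by rewrite scalerBl opprB [RHS]addrC addrA subrK.
exact: is_idealB.
Qed.

(** [x] is the value at [m] of the partial character of the cell: the ratio,
   modulo [J], of two monomials whose exponents differ by [m]. *)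
Definition cell_ratio (m : Zn) x : Prop := x != 0 /\ exists a b,
  [/\ supported_on a, supported_on b, mnm_diff a b = m & J ('X_[a] - x *: 'X_[b])].

Definition cell_lat : set Zn := [set m | exists x, cell_ratio m x].
Definition cell_val (m : Zn) : F := xget 1 [set x | cell_ratio m x].

Lemma cell_ratio_uniq m x y : cell_ratio m x -> cell_ratio m y -> x = y.
Proof.
move=> [_ [a [b [aE bE abm Jx]]]] [_ [a' [b' [aE' bE' abm' Jy]]]].
apply: (cell_binomial_uniq (a := a) bE Jx).
by apply: cell_binomial_diff Jy bE => //; rewrite abm abm'.
Qed.

Lemma cell_valP m : cell_lat m -> cell_ratio m (cell_val m).
Proof. by case=> x mx; apply: (@xgetPex _ 1 [set x | cell_ratio m x]); exists x. Qed.

Lemma cell_valE m x : cell_ratio m x -> cell_val m = x.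
Proof.
by move=> mx; apply: (@cell_ratio_uniq m) => //; apply: cell_valP; exists x.
Qed.

Lemma cell_lat_supp m : cell_lat m -> forall i, i \notin E -> m i = 0.
Proof.
by move=> [x [_ [a [b [aE bE <- _]]]]] i iE; rewrite ffunE aE // bE.
Qed.

Lemma supported_onD a b : supported_on a -> supported_on b -> supported_on (a + b)%MM.
Proof. by move=> aE bE i iE; rewrite mnmDE aE // bE. Qed.

Lemma cell_ratioM m m' x y :
  cell_ratio m x -> cell_ratio m' y -> cell_ratio (m + m') (x * y).
Proof.
move=> [x0 [a [b [aE bE <- Jx]]]] [y0 [a' [b' [aE' bE' <- Jy]]]].
split; first exact: mulf_neq0.
exists (a + a')%MM, (b + b')%MM; split; try exact: supported_onD.
  by apply/ffunP => i; rewrite !ffunE !mnmDE; lia.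
have -> : 'X_[a + a'] - (x * y) *: 'X_[b + b'] =
    'X_[a'] * ('X_[a] - x *: 'X_[b]) + (x *: 'X_[b]) * ('X_[a'] - y *: 'X_[b']) :> R.
  rewrite !mpolyXD -!mul_mpolyC rmorphM /=; ring.
by apply: is_idealD => //; apply: is_idealM.
Qed.

Lemma cell_ratioV m x : cell_ratio m x -> cell_ratio (- m) x^-1.
Proof.
move=> [x0 [a [b [aE bE <- Jx]]]]; split; first by rewrite invr_eq0.
exists b, a; split=> //; first by apply/ffunP => i; rewrite !ffunE opprB.
have -> : 'X_[b] - x^-1 *: 'X_[a] = - x^-1 *: ('X_[a] - x *: 'X_[b]) :> R.
  by rewrite scalerBr scalerA !scaleNr mulNr mulVf // scaleNr opprK scale1r addrC.
exact: is_idealZ.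
Qed.

Lemma cell_lat0 : cell_lat 0.
Proof.
have E0 : supported_on 0%MM by move=> i _; rewrite mnm0E.
exists 1; split; first exact: oner_neq0.
exists 0%MM, 0%MM; split=> //; first by apply/ffunP => i; rewrite !ffunE subrr.
by rewrite scale1r subrr; apply: is_ideal0.
Qed.

Lemma cell_latB m m' : cell_lat m -> cell_lat m' -> cell_lat (m - m').
Proof. by move=> [x mx] [y my]; exists (x / y); apply/cell_ratioM/cell_ratioV. Qed.

Lemma cell_val_neq0 m : cell_lat m -> cell_val m != 0.
Proof. by move=> /cell_valP[]. Qed.

Lemma cell_valD m m' : cell_lat m -> cell_lat m' ->
  cell_val (m + m') = cell_val m * cell_val m'.
Proof. by move=> /cell_valP mx /cell_valP my; apply: cell_valE; apply: cell_ratioM. Qed.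

Definition cell_character : partial_character F E :=
  PartialCharacter cell_lat_supp cell_lat0 cell_latB cell_val_neq0 cell_valD.

(** A member of [J] in the variables of the cell is a sum of binomials of [J] in
   these variables.  None of them is a monomial, since the cell monomials are
   nonzerodivisors modulo the proper ideal [J], so each is a multiple of a
   generator of the lattice ideal. *)
Theorem cell_data_exists : cell_data J cell_character.
Proof.
split=> //; apply/seteqP; split=> p.
  move=> [Jp pE]; have [s ps sJ] := binomial_ideal_support J_binomial Jp.
  rewrite ps big_seq; apply: (big_ind (lattice_ideal cell_character)).
  - exact: ideal_span_in0.
  - exact: ideal_span_inD.
  move=> q /sJ[Jq]; rewrite /Defs.binomial => q2 qp.
  have qE a : a \in msupp q -> supported_on a by move=> /qp/pE.
  case q_supp : (msupp q) q2 => [|a [|b [|//]]] _.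
  - by rewrite (msuppnil0 q_supp); exact: ideal_span_in0.
  - have aq : a \in msupp q by rewrite q_supp mem_head.
    case: (@cell_no_monomial a (qE a aq)).
    have -> : 'X_[a] = (q@_a)^-1 *: q.
      rewrite [X in _ *: X](mpolyE q) q_supp big_seq1 scalerA mulVf ?scale1r //.
      by rewrite -mcoeff_msupp.
    exact: is_idealZ.
  have aq : a \in msupp q by rewrite q_supp mem_head.
  have bq : b \in msupp q by rewrite q_supp !inE eqxx orbT.
  have qa : q@_a != 0 by rewrite -mcoeff_msupp.
  have qb : q@_b != 0 by rewrite -mcoeff_msupp.
  pose x := - q@_b / q@_a.
  have qE' : q = q@_a *: ('X_[a] - x *: 'X_[b]).
    rewrite [LHS]mpolyE q_supp big_cons big_seq1 scalerBr scalerA /x.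
    by rewrite mulrCA divff // mulr1 scaleNr opprK.
  have abx : cell_ratio (mnm_diff a b) x.
    split; first by rewrite mulf_neq0 ?oppr_eq0 ?invr_eq0.
    exists a, b; split=> //; [exact: qE|exact: qE|].
    rewrite -['X_[a] - _]scale1r -(mulVf qa) -scalerA -qE'.
    exact: is_idealZ.
  rewrite qE'; apply: lattice_idealZ; rewrite -(cell_valE abx).
  by apply: (@lattice_ideal_binomial _ _ _ cell_character); [exact: qE|exists x].
move=> sp; split; last exact: lattice_ideal_sub_subring sp.
move: p sp; apply: ideal_span_in_sub => // _ [m Lm ->].
have [_ [a [b [aE bE abm Jab]]]] := cell_valP Lm.
apply: cell_binomial_diff Jab _ => //; first by rewrite pos_neg_part.
by apply: supported_neg_part; apply: cell_lat_supp.
Qed.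

End CellularIdeals.

Section CellRadical.
Variables (F : fieldType) (Omega : closedFieldType) (f : {rmorphism F -> Omega}).
Variables (n : nat) (E : {set 'I_n}) (sigma : partial_character F E).
Variable J : set {mpoly F[n]}.
Hypotheses (char_Omega : [pchar Omega] =i pred0) (J_ideal : is_ideal J).
Hypothesis J_data : cell_data J sigma.

Lemma mpoly_cell_split (p : {mpoly F[n]}) :
  exists q r, [/\ p = q + r, subring_in E q & ideal_M E r].
Proof.
have EP a : reflect (supported_on E a) [forall i, (i \notin E) ==> (a i == 0%N)].
  apply: (iffP forallP) => [h i iE|h i]; last by apply/implyP => /h->.
  by have /implyP/(_ iE)/eqP := h i.
pose on a := [forall i, (i \notin E) ==> (a i == 0%N)].
exists (\sum_(a <- msupp p | on a) p@_a *: 'X_[a]),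
  (\sum_(a <- msupp p | ~~ on a) p@_a *: 'X_[a]); split.
- by rewrite {1}[p]mpolyE; exact: bigID.
- apply: (big_ind (subring_in E)); [exact: subring_in0|exact: subring_inD|].
  by move=> a /EP aE; apply/subring_inZ/subring_inX.
- apply: is_ideal_sum => [|a /EP naE]; first exact: ideal_M_is_ideal.
  by apply: is_idealZ; [exact: ideal_M_is_ideal|exact: ideal_M_monomial].
Qed.

Lemma ideal_M_sub_radical : ideal_M E `<=` radical J.
Proof.
apply: ideal_span_sub; first exact: radical_is_ideal.
move=> _ [i iE ->]; case: J_data => -[_ Jc] Ji _.
by case: (Jc i) => // /Ji; rewrite (negPf iE).
Qed.

(** Modulo the radical a polynomial may be replaced by its part in the variables
   of the cell; a power of this part is in the lattice ideal, which is radical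
   in characteristic 0. *)
Theorem cell_radical : radical J = ideal_P sigma.
Proof.
have radJ := radical_is_ideal J_ideal.
case: (J_data) => _ _ JE; apply/seteqP; split=> p.
  have [q [r [-> qE Mr]]] := mpoly_cell_split p.
  move=> Jqr; have [d Jq] : radical J q.
    by rewrite -[q](addrK r); apply: is_idealB => //; apply: ideal_M_sub_radical.
  apply: is_idealD; [exact: ideal_P_is_ideal| |exact: ideal_M_sub_P].
  apply: (ideal_P_radical f char_Omega (d := d)); apply: lattice_ideal_sub_P.
  rewrite -JE; split=> //; elim: (d) => [|e IH]; last by rewrite exprS; apply: subring_inM.
  by rewrite expr0 -mpolyX0; apply: subring_inX => i _; rewrite mnm0E.
move: p; apply: ideal_add_sub => //; first exact: ideal_M_sub_radical.
apply: ideal_span_sub => //; rewrite -JE => p [Jp _]; exact: sub_radical.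
Qed.

Lemma cell_radical_span :
  radical J = ideal_add (ideal_span (J `&` subring_in E)) (ideal_M E).
Proof. by rewrite cell_radical ideal_addC; case: J_data => _ _ ->. Qed.

End CellRadical.

(** * Saturations of a partial character *)

Section CharacterValues.
Variables (F : fieldType) (n : nat) (E : {set 'I_n}) (sigma : partial_character F E).
Local Notation Zn := {ffun 'I_n -> int}.
Local Notation L := (pc_lat sigma).

Lemma pc_val0 : pc_val sigma 0 = 1.
Proof.
have L0 := pc_lat0 sigma; apply: (mulfI (pc_val_neq0 L0)).
by rewrite -pc_valD // addr0 mulr1.
Qed.

Lemma pc_valN (m : Zn) : L m -> pc_val sigma (- m) = (pc_val sigma m)^-1.
Proof.
move=> Lm; have LN := subgroupN (pc_subgroup sigma) Lm.
apply: (mulfI (pc_val_neq0 Lm)).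
by rewrite -pc_valD // subrr pc_val0 mulfV ?pc_val_neq0.
Qed.

Lemma pc_valMz (m : Zn) z : L m -> pc_val sigma (m *~ z) = pc_val sigma m ^ z.
Proof.
move=> Lm; have sL := pc_subgroup sigma.
have valMn d : pc_val sigma (m *+ d) = pc_val sigma m ^+ d.
  elim: d => [|d IH]; first by rewrite mulr0n pc_val0 expr0.
  by rewrite mulrS exprS pc_valD ?IH //; apply: (subgroupMz (Posz d) sL).
case: z => d; first exact: valMn.
rewrite {1}NegzE mulrNz pc_valN; last exact: (subgroupMz (Posz d.+1) sL).
by rewrite -[_ ^ Negz d]/((pc_val sigma m ^+ d.+1)^-1) -valMn.
Qed.

Lemma pc_val_sum (g : 'I_n -> Zn) (c : 'I_n -> int) : (forall i, L (g i)) ->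
  pc_val sigma (\sum_i g i *~ c i) = \prod_i pc_val sigma (g i) ^ c i.
Proof.
move=> Lg; have sL := pc_subgroup sigma.
suff [] : L (\sum_i g i *~ c i) /\
  pc_val sigma (\sum_i g i *~ c i) = \prod_i pc_val sigma (g i) ^ c i by [].
elim/big_ind2 : _ => [|x1 y1 x2 y2 [L1 <-] [L2 <-]|i _].
- by split; [exact: pc_lat0|exact: pc_val0].
- by split; [exact: subgroupD|rewrite pc_valD].
- by split; [exact: subgroupMz|rewrite pc_valMz].
Qed.

End CharacterValues.

Lemma finitely_many_roots (F : fieldType) (p : {poly F}) :
  p != 0 -> exists s : seq F, forall x, root p x -> x \in s.
Proof.
move: {2}(size p) (leqnn (size p)) => N; elim: N p => [|N IH] p pN p0.
  by case/negP: p0; rewrite -size_poly_eq0 -leqn0.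
have [[a pa]|nr] := pselect (exists a, root p a); last first.
  by exists [::] => x px; case: nr; exists x.
have /factor_theorem[q pq] := pa.
have q0 : q != 0 by apply: contraNneq p0 => q0; rewrite pq q0 mul0r.
have [||s sP] := IH q; rewrite // ?pq ?size_Mmonic ?monicXsubC // in pN *.
  by move: pN; rewrite size_XsubC addn2.
exists (a :: s) => x; rewrite rootM root_XsubC inE => /orP[/sP->|->//].
by rewrite orbT.
Qed.

Section Saturations.
Variables (k K : fieldType) (iota : {rmorphism k -> K}).
Variables (n : nat) (E : {set 'I_n}) (sigma : partial_character k E).
Local Notation Zn := {ffun 'I_n -> int}.
Local Notation L := (pc_lat sigma).

Lemma sub_Sat : L `<=` Sat L.
Proof. by move=> m Lm; exists 1; rewrite ?mulr1z. Qed.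

Lemma Sat_subgroup : subgroup (Sat L).
Proof.
have sL := pc_subgroup sigma; split; first exact/sub_Sat/pc_lat0.
move=> a b [d d0 La] [e e0 Lb]; exists (d * e); first by rewrite mulf_neq0.
rewrite mulrzBl mulrzA [d * e]mulrC mulrzA; apply: pc_latB; exact: subgroupMz.
Qed.

Lemma Sat_Sat : Sat (Sat L) `<=` Sat L.
Proof.
move=> m [d d0 [e e0 Lm]]; exists (d * e); first by rewrite mulf_neq0.
by rewrite mulrzA.
Qed.

Lemma Sat_supp m : Sat L m -> forall i, i \notin E -> m i = 0.
Proof.
move=> [d d0 Lm] i iE; apply: (mulIf d0).
by rewrite mul0r -int_ffunMz (pc_supp Lm iE).
Qed.

(** A saturation is determined by its values at finitely many generators of
   [Sat L], each of which is a root of a fixed binomial. *)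
Lemma finitely_many_saturations :
  exists l (tau : 'I_l -> partial_character K E), all_saturations iota sigma tau.
Proof.
have [g [Lg g_gen]] := lattice_fingen Sat_subgroup.
have /(@choice _ _ (fun i (s : seq K) => forall tau, saturation iota sigma tau ->
    pc_val tau (g i) \in s))[rts rtsP] :
  forall i, exists s : seq K, forall tau, saturation iota sigma tau ->
    pc_val tau (g i) \in s.
  move=> i; have [d d0 Ld] := Lg i.
  have {}Ld : L (g i *~ `|d|%N).
    by case: (d) Ld => e // /(subgroupN (pc_subgroup sigma)); rewrite -mulrNz.
  have d_gt0 : (0 < `|d|)%N by rewrite absz_gt0.
  have [|s sP] := @finitely_many_roots K ('X^`|d| - (iota (pc_val sigma (g i *~ `|d|%N)))%:P).
    by rewrite -size_poly_gt0 size_XnsubC.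
  exists s => tau [tau_lat tauE]; apply: sP.
  rewrite rootE !hornerE subr_eq0 -tauE // pc_valMz ?tau_lat //.
pose S := flatten [seq rts i | i <- enum 'I_n].
have in_S i x : x \in rts i -> x \in S.
  by move=> xi; apply/flattenP; exists (rts i) => //; apply: map_f; rewrite mem_enum.
pose taken (h : {ffun 'I_n -> seq_sub S}) (tau : partial_character K E) :=
  saturation iota sigma tau /\ forall i, pc_val tau (g i) = val (h i).
pose A := [pred h | `[< exists tau, taken h tau >]].
have A_ex (j : 'I_#|A|) : exists tau, taken (enum_val j) tau.
  by have /asboolP := enum_valP j.
exists #|A|, (fun j => projT1 (cid (A_ex j))); split=> [j|tau tau_sat].
  by case: (cid _) => tau /= [].
pose h := [ffun i => SeqSub (in_S i _ (rtsP i tau tau_sat))].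
have tau_h : taken h tau by split=> // i; rewrite ffunE.
have Ah : h \in A by apply/asboolP; exists tau.
exists (enum_rank_in Ah h) => m.
case: (cid _) => tau' /= []; rewrite enum_rankK_in // => -[lat' _] tau'h.
case: (tau_sat) => lat _; rewrite lat => /g_gen[c ->].
rewrite !pc_val_sum ?lat ?lat' //; apply: eq_bigr => i _.
by rewrite tau'h; case: tau_h => _ ->.
Qed.

Definition map_character : partial_character K E.
Proof.
refine (@PartialCharacter _ _ _ L (fun m => iota (pc_val sigma m))
  (@pc_supp _ _ _ sigma) (pc_lat0 sigma) (@pc_latB _ _ _ sigma) _ _).
- by move=> m Lm; rewrite fmorph_eq0; apply: pc_val_neq0.
- by move=> m m' Lm Lm'; rewrite pc_valD // rmorphM.
Defined.

Lemma preimage_is_ideal (P : set {mpoly K[n]}) :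
  is_ideal P -> is_ideal [set p | P (map_mpoly iota p)].
Proof.
move=> Pid; split; first by rewrite /= raddf0; apply: is_ideal0.
  by move=> p q /= Pp Pq; rewrite raddfD; apply: is_idealD.
by move=> p q /= Pq; rewrite rmorphM; apply: is_idealM.
Qed.

Lemma map_lattice_binomial (m : Zn) x :
  map_mpoly iota ('X_[pos_part m] - x *: 'X_[neg_part m]) =
  'X_[pos_part m] - iota x *: 'X_[neg_part m].
Proof. by rewrite raddfB /= map_mpolyZ !map_mpolyX. Qed.

(** [sigma] and [tau] agree on the lattice of [sigma], so that the generators for
   [sigma] are mapped to generators for [tau]. *)
Lemma ideal_P_saturation tau : saturation iota sigma tau ->
  ideal_P sigma `<=` [set p | ideal_P tau (map_mpoly iota p)].
Proof.
move=> [lat val_tau].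
have Iid := preimage_is_ideal (ideal_P_is_ideal tau).
apply: ideal_add_sub => //; apply: ideal_span_sub => //.
  move=> _ [i iE ->] /=; rewrite map_mpolyX; apply: ideal_M_sub_P.
  by apply: ideal_span_gen; exists i.
apply: ideal_span_in_sub => // _ [m Lm ->] /=.
rewrite map_lattice_binomial -val_tau //; apply: lattice_ideal_sub_P.
by apply: lattice_ideal_gen; rewrite lat; apply: sub_Sat.
Qed.

Variable J : set {mpoly k[n]}.
Hypothesis J_data : cell_data J sigma.

Lemma map_mpoly_ideal_extension p : J p -> ideal_extension iota J (map_mpoly iota p).
Proof. by move=> Jp; apply: ideal_span_gen; exists p. Qed.

Lemma ideal_P_map_sub_radical : ideal_P map_character `<=` radical (ideal_extension iota J).
Proof.
have Rid : is_ideal (radical (ideal_extension iota J)).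
  exact/radical_is_ideal/ideal_span_is_ideal.
case: J_data => -[_ Jc] Ji JE.
apply: ideal_add_sub => //; apply: ideal_span_sub => //.
  move=> _ [i iE ->]; case: (Jc i) => [/Ji|[d Jd]]; first by rewrite (negPf iE).
  exists d; rewrite -['X_i](map_mpolyX iota) -rmorphXn /=.
  exact: map_mpoly_ideal_extension.
apply: ideal_span_in_sub => // _ [m Lm ->] /=; apply: sub_radical.
rewrite -map_lattice_binomial; apply: map_mpoly_ideal_extension.
by have := lattice_ideal_gen (sigma := sigma) Lm; rewrite -JE => -[].
Qed.

Variables (Kbar : closedFieldType) (jota : {rmorphism K -> Kbar}).
Hypothesis char_Kbar : [pchar Kbar] =i pred0.

Lemma saturation_prime tau : saturation iota sigma tau -> prime_ideal (ideal_P tau).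
Proof.
move=> [lat _]; apply: (saturated_ideal_P_prime jota char_Kbar).
by rewrite lat; apply: Sat_Sat.
Qed.

(** A torus point restricts to a character of [Sat L], which has values in [K]
   and hence belongs to the list: so the torus points of [sigma] are those of
   its saturations. *)
Lemma torus_point_saturation l (tau : 'I_l -> partial_character K E) v :
  all_saturations iota sigma tau -> saturations_defined_over iota jota sigma ->
  torus_point jota map_character v -> exists j, torus_point jota (tau j) v.
Proof.
move=> [tau_sat tau_all] sdo [v0 vL]; have sS := Sat_subgroup.
have vE i : i \in E -> v i != 0 by rewrite v0.
have zpow0 m : Sat L m -> zpow v m != 0.
  move=> /Sat_supp mE; apply/prodf_neq0 => i _.
  have [/vE vi|/mE->] := boolP (i \in E); [exact: expfz_neq0|].
  by rewrite expr0z oner_neq0.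
have zpowD m m' : Sat L m -> Sat L m' -> zpow v (m + m') = zpow v m * zpow v m'.
  move=> /Sat_supp mE /Sat_supp mE'; rewrite -big_split; apply: eq_bigr => i _ /=.
  rewrite ffunE; have [/vE vi|iE] := boolP (i \in E); first by rewrite expfzDr.
  by rewrite mE // mE' // addr0 !expr0z mulr1.
pose tau1 := @PartialCharacter Kbar n E (Sat L) (zpow v) Sat_supp
  (proj1 sS) (proj2 sS) zpow0 zpowD.
have tau1_sat : saturation (jota \o iota) sigma tau1 by split=> // m /vL.
pose val2 m := xget 1 [set x | zpow v m = jota x].
have val2P m : Sat L m -> zpow v m = jota (val2 m).
  by move=> Sm; apply: (@xgetPex _ 1 [set x | zpow v m = jota x]); apply: sdo tau1_sat m Sm.
have val2_0 m : Sat L m -> val2 m != 0.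
  by move=> Sm; rewrite -(fmorph_eq0 jota) -val2P // zpow0.
have val2D m m' : Sat L m -> Sat L m' -> val2 (m + m') = val2 m * val2 m'.
  move=> Sm Sm'; apply: (fmorph_inj jota); rewrite rmorphM /= -!val2P ?zpowD //.
  exact: subgroupD.
pose tau2 := @PartialCharacter K n E (Sat L) val2 Sat_supp
  (proj1 sS) (proj2 sS) val2_0 val2D.
have tau2_sat : saturation iota sigma tau2.
  split=> // m Lm; apply: (fmorph_inj jota); rewrite -[RHS]vL //= -val2P //.
  exact: sub_Sat.
have [j tau2j] := tau_all _ tau2_sat.
exists j; split=> // m; have [-> _] := tau_sat j => Sm.
by rewrite -tau2j ?val2P.
Qed.

(** A polynomial in all the [ideal_P (tau j)] vanishes at the torus points of all
   saturations, hence at those of [sigma] over [K]. *)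
Lemma bigcap_saturations_sub_radical l (tau : 'I_l -> partial_character K E) p :
  all_saturations iota sigma tau -> saturations_defined_over iota jota sigma ->
  (forall j, ideal_P (tau j) p) -> radical (ideal_extension iota J) p.
Proof.
move=> tau_all sdo p_tau; apply: ideal_P_map_sub_radical.
apply/(lattice_nullstellensatz jota _ char_Kbar) => v.
by case/(torus_point_saturation tau_all sdo) => j vT; apply: ideal_P_vanish vT p (p_tau j).
Qed.

End Saturations.

(** * Termination, and the ideals saved by an execution *)

Section SplittingStep.
Variables (F : fieldType) (n : nat).
Local Notation R := {mpoly F[n]}.
Implicit Types (I J : set R) (i : 'I_n).

Lemma split_add_is_ideal I i : is_ideal I -> is_ideal (split_add I i).
Proof. by move=> Iid; apply: ideal_add_is_ideal => //; apply: ideal_span_is_ideal. Qed.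

Lemma split_sat_is_ideal I i : is_ideal I -> is_ideal (split_sat I i).
Proof. exact: saturate_is_ideal. Qed.

Lemma sub_split_add I i : I `<=` split_add I i.
Proof. by apply: ideal_addl; apply: ideal_span_is_ideal. Qed.

Lemma split_addX I i : is_ideal I -> split_add I i 'X_i.
Proof. by move=> Iid; apply: ideal_addr => //; apply: ideal_span_gen. Qed.

Lemma ideal_span1 (q p : R) : ideal_span [set q] p -> exists a, p = a * q.
Proof.
move=> [r [a [g [_ gq ->]]]]; exists (\sum_j a j); rewrite mulr_suml.
by apply: eq_bigr => j _; rewrite (gq j).
Qed.

(** A zerodivisor modulo [I] is not a unit modulo [I]. *)
Lemma split_add_proper I i : is_ideal I -> zerodivisor_mod I 'X_i ->
  is_proper (split_add I i).
Proof.
move=> Iid [p nIp IXp] [a [b [Ia /ideal_span1[c ->] e1]]]; apply: nIp.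
rewrite -[p]mul1r e1 mulrDl -mulrA; apply: is_idealD => //.
  exact: is_idealMr.
exact: is_idealM.
Qed.

Lemma split_sat_proper I i : ~ nilpotent_mod I 'X_i -> is_proper (split_sat I i).
Proof. by move=> nnil [d]; rewrite mulr1 => Id; apply: nnil; exists d. Qed.

Lemma exists_splitting_variable I : is_proper I -> ~ cellular I ->
  exists i, splitting_variable I i.
Proof.
move=> I1 ncell; apply: contrapT => nsplit; apply: (ncell); split=> // i.
apply: contrapT => /not_orP[nnz nnil]; apply: nsplit; exists i; split=> //.
exact: not_nonzerodivisor_mod.
Qed.

Definition num_non_nilpotent I : nat := #|[pred i | ~~ `[< nilpotent_mod I 'X_i >]]|.
Definition num_zerodivisors I : nat := #|[pred i | ~~ `[< nonzerodivisor_mod I 'X_i >]]|.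

(** The lexicographic order on pairs, encoded by one number because the second
   component is at most [n]. *)
Definition split_measure I : nat := num_non_nilpotent I * n.+1 + num_zerodivisors I.

Lemma nilpotent_mod_sub I J q : I `<=` J -> nilpotent_mod I q -> nilpotent_mod J q.
Proof. by move=> IJ [d Id]; exists d; apply: IJ. Qed.

Lemma nonzerodivisor_mod_saturate I q r :
  nonzerodivisor_mod I q -> nonzerodivisor_mod (saturate I r) q.
Proof. by move=> nz p [d]; rewrite mulrCA => /nz; exists d. Qed.

Lemma nonzerodivisor_mod_self I q : nonzerodivisor_mod (saturate I q) q.
Proof. by move=> p [d]; rewrite mulrA -exprSr; exists d.+1. Qed.

(** Adding [x_i] makes it nilpotent and keeps the nilpotent variables nilpotent;
   saturating makes it a nonzerodivisor and preserves both nilpotency and being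
   a nonzerodivisor. *)
Lemma recursive_call_measure I J : is_ideal I -> recursive_call I J ->
  (split_measure J < split_measure I)%N.
Proof.
move=> Iid [i [_ [p nIp IXp] nnil] [->|->]].
  have lt1 : (num_non_nilpotent (split_add I i) < num_non_nilpotent I)%N.
    apply/proper_card/fintype.properP; split.
      apply/fintype.subsetP => j; rewrite !inE; apply: contraNN => /asboolP h.
      by apply/asboolP; apply: nilpotent_mod_sub h; apply: sub_split_add.
    exists i; rewrite !inE; first exact/asboolPn.
    by rewrite negbK; apply/asboolP; exists 1%N; rewrite expr1; apply: split_addX.
  have le2 : (num_zerodivisors (split_add I i) <= n)%N.
    by rewrite -[X in (_ <= X)%N]card_ord max_card.
  rewrite /split_measure; apply: (@leq_trans ((num_non_nilpotent (split_add I i)).+1 * n.+1)).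
    by rewrite mulSn addnC ltn_add2r ltnS.
  by apply: leq_trans (leq_addr _ _); rewrite leq_mul2r lt1 orbT.
rewrite /split_measure -addnS leq_add //.
  rewrite leq_mul2r; apply/orP; right; apply/subset_leq_card/fintype.subsetP => j.
  rewrite !inE; apply: contraNN => /asboolP h; apply/asboolP.
  by apply: nilpotent_mod_sub h; apply: sub_saturate.
apply/proper_card/fintype.properP; split.
  apply/fintype.subsetP => j; rewrite !inE; apply: contraNN => /asboolP h; apply/asboolP.
  exact: nonzerodivisor_mod_saturate.
exists i; rewrite !inE; first by apply/asboolPn => nz; apply/nIp/nz.
by rewrite negbK; apply/asboolP; apply: nonzerodivisor_mod_self.
Qed.

Definition proper_binomial I : Prop := binomial_ideal I /\ is_proper I.

Lemma recursive_call_proper_binomial I J :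
  recursive_call I J -> proper_binomial I -> proper_binomial J.
Proof.
move=> [i [_ zd nnil] [->|->]] [Ib Ip]; split.
- exact: binomial_ideal_add_var.
- exact: split_add_proper (binomial_ideal_is_ideal Ib) zd.
- exact: binomial_ideal_saturate.
- exact: split_sat_proper.
Qed.

Lemma reachable_proper_binomial I J :
  reachable I J -> proper_binomial I -> proper_binomial J.
Proof.
by elim=> [x y /recursive_call_proper_binomial| |x y z _ h1 _ h2 /h1/h2].
Qed.

Lemma recursive_call_wf I : proper_binomial I ->
  Acc (fun J' J => recursive_call J J') I.
Proof.
move: {2}(split_measure I) (leqnn (split_measure I)) => N.
elim: N I => [|N IH] I IN Ipb; constructor => J IJ;
  have lt := recursive_call_measure (binomial_ideal_is_ideal (proj1 Ipb)) IJ.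
  by move: lt; rewrite ltnNge (leq_trans IN).
apply: IH; last exact: recursive_call_proper_binomial IJ Ipb.
by rewrite -ltnS; apply: leq_trans lt IN.
Qed.

End SplittingStep.

Section MinimalMembers.
Variables (T : Type) (S : set (set T)).

(** Among the members contained in [P], take one that contains the least number
   of members. *)
Lemma finite_has_minimal (X : finType) (s : X -> set T) (P : set T) :
  (forall Q, S Q <-> exists x, Q = s x) -> S P ->
  exists2 Q, S Q /\ (forall Q', S Q' -> Q' `<=` Q -> Q' = Q) & Q `<=` P.
Proof.
move=> sS /sS[x0 Px0].
pose below x := [pred y | `[< s y `<=` s x >]].
have Pb : `[< s x0 `<=` P >] by rewrite -Px0; apply/asboolP.
case: (arg_minnP (fun x => #|below x|) (P := fun x => `[< s x `<=` P >]) Pb).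
move=> x /asboolP xP x_min; exists (s x) => //; split; first by apply/sS; exists x.
move=> _ /sS[y ->] yx; apply/seteqP; split=> //.
apply/asboolP; have yP : `[< s y `<=` P >] by apply/asboolP => z /yx/xP.
have := x_min y yP; rewrite leqNgt; apply: contraNT => nxy.
apply/proper_card/fintype.properP; split.
  by apply/fintype.subsetP => z; rewrite !inE => zy w /zy/yx.
by exists x; rewrite !inE.
Qed.

End MinimalMembers.

Section Traces.
Variables (k K : fieldType) (iota : {rmorphism k -> K}) (n : nat).
Implicit Types (I J : set {mpoly k[n]}) (t : trace k K n) (P Q : set {mpoly K[n]}).

Lemma execution_exists I : proper_binomial I -> exists t, execution iota I t.
Proof.
move=> Ipb; have wf := recursive_call_wf Ipb.
elim: wf Ipb => {}I _ IH [Ib Ip].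
have [Icell|Incell] := pselect (cellular I).
  pose E : {set 'I_n} := [set i | `[< nonzerodivisor_mod I 'X_i >]]%SET.
  have IE : cell_indices I E by move=> i; rewrite inE; split=> /asboolP.
  have Idata := cell_data_exists Ib Icell IE.
  have [l [tau tau_all]] :=
    finitely_many_saturations iota (cell_character Ib Icell IE).
  by exists (Cell (cell_character Ib Icell IE) tau).
have [i Ii] := exists_splitting_variable Ip Incell.
have Ia : recursive_call I (split_add I i) by exists i => //; left.
have Is : recursive_call I (split_sat I i) by exists i => //; right.
have [t1 e1] := IH _ Ia (recursive_call_proper_binomial Ia (conj Ib Ip)).
have [t2 e2] := IH _ Is (recursive_call_proper_binomial Is (conj Ib Ip)).
by exists (Defs.Split i t1 t2).
Qed.

Lemma saved_finite t : exists (X : finType) (s : X -> set {mpoly K[n]}),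
  forall Q, saved t Q <-> exists x, Q = s x.
Proof.
elim: t => [E sigma l tau|i t1 [X1 [s1 sE1]] t2 [X2 [s2 sE2]]] /=.
  by exists 'I_l, (fun j => ideal_P (tau j)).
exists (X1 + X2)%type, (fun x => match x with inl x => s1 x | inr x => s2 x end) => Q.
split=> [[/sE1[x ->]|/sE2[x ->]]|[[x|x] ->]]; [by exists (inl x)|by exists (inr x)|..].
  by left; apply/sE1; exists x.
by right; apply/sE2; exists x.
Qed.

Lemma saved_has_remaining t P :
  saved t P -> exists2 Q, remaining (saved t) Q & Q `<=` P.
Proof. by have [X [s sE]] := saved_finite t; apply: finite_has_minimal sE. Qed.

Lemma saved_is_ideal t P : saved t P -> is_ideal P.
Proof.
elim: t => [E sigma l tau [j ->]|i t1 IH1 t2 IH2 [/IH1|/IH2]] //.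
exact: ideal_P_is_ideal.
Qed.

(** Otherwise each of the finitely many saved ideals has an element outside [Q],
   and the product of these elements lies in all of them but not in [Q]. *)
Lemma saved_sub_prime t Q : prime_ideal Q ->
  (forall p, (forall P, saved t P -> P p) -> Q p) ->
  exists2 P, saved t P & P `<=` Q.
Proof.
move=> [Qid Q1 Qm] tQ; apply: contrapT => nPQ.
suff [p nQp tp] : exists2 p, ~ Q p & forall P, saved t P -> P p by apply/nQp/tQ.
have {tQ nPQ} : forall P, saved t P -> ~ P `<=` Q.
  by move=> P tP PQ; apply: nPQ; exists P.
have QM p q : ~ Q p -> ~ Q q -> ~ Q (p * q) by move=> np nq /Qm[].
elim: t => [E sigma l tau|i t1 IH1 t2 IH2] /= nPQ.
  have /choice[p pP] : forall j, exists p, ideal_P (tau j) p /\ ~ Q p.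
    move=> j; have /existsNP[p /not_implyP[]] := nPQ _ (ex_intro _ j erefl).
    by exists p.
  exists (\prod_j p j); first by apply: (big_ind (fun q => ~ Q q)) => // j _; case: (pP j).
  move=> _ [j ->]; rewrite (bigD1 j) //=; apply: is_idealMr; last by case: (pP j).
  exact: ideal_P_is_ideal.
have [|p1 nQ1 t1p] := IH1; first by move=> P tP; apply: nPQ; left.
have [|p2 nQ2 t2p] := IH2; first by move=> P tP; apply: nPQ; right.
exists (p1 * p2); first exact: QM.
move=> P [tP|tP]; have Pid := saved_is_ideal tP.
  by apply: is_idealMr => //; apply: t1p.
by apply: is_idealM => //; apply: t2p.
Qed.

Lemma ideal_extension_is_ideal I : is_ideal (ideal_extension iota I).
Proof. exact: ideal_span_is_ideal. Qed.

Lemma ideal_extension_sub I P : is_ideal P ->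
  I `<=` [set p | P (map_mpoly iota p)] -> ideal_extension iota I `<=` P.
Proof. by move=> Pid IP; apply: ideal_span_sub => // _ [p /IP Pp <-]. Qed.

(** Let [p ^ d1 = a + b x_i] with [a] in the extension of [I], which also contains
   [x_i ^ e p ^ d2].  Modulo this extension, [(p ^ d1) ^ e p ^ d2] is equal to
   [b ^ e x_i ^ e p ^ d2] and thus to 0. *)
Lemma radical_split I i p : is_ideal I ->
  radical (ideal_extension iota (split_add I i)) p ->
  radical (ideal_extension iota (split_sat I i)) p ->
  radical (ideal_extension iota I) p.
Proof.
move=> Iid [d1 Ip1] [d2 Ip2]; set I' := ideal_extension iota I.
have I'id : is_ideal I' := ideal_extension_is_ideal I.
have {Ip1} [a [b [I'a pE]]] : exists a b, I' a /\ p ^+ d1 = a + b * 'X_i.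
  suff /(_ _ Ip1)[a [_ [I'a /ideal_span1[b ->] pE]]] :
    ideal_extension iota (split_add I i) `<=` ideal_add I' (ideal_span [set 'X_i]).
    by exists a, b.
  have I'Xid : is_ideal (ideal_add I' (ideal_span [set 'X_i])).
    by apply: ideal_add_is_ideal => //; apply: ideal_span_is_ideal.
  apply: ideal_extension_sub => //; apply: ideal_add_sub.
  - exact: preimage_is_ideal.
  - move=> q Iq /=; apply: ideal_addl; first exact: ideal_span_is_ideal.
    exact: map_mpoly_ideal_extension.
  - apply: ideal_span_sub; first exact: preimage_is_ideal.
    by move=> _ -> /=; rewrite map_mpolyX; apply: ideal_addr => //; apply: ideal_span_gen.
have {Ip2} [e I'p2] : saturate I' 'X_i (p ^+ d2).
  move: Ip2; apply: ideal_extension_sub; first exact: saturate_is_ideal.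
  move=> q [e Ieq]; exists e; rewrite -['X_i](map_mpolyX iota) -rmorphXn -rmorphM.
  exact: map_mpoly_ideal_extension.
exists (d1 * e + d2)%N; rewrite exprD exprM.
have -> : (p ^+ d1) ^+ e * p ^+ d2 = ((p ^+ d1) ^+ e - (b * 'X_i) ^+ e) * p ^+ d2
    + b ^+ e * ('X_i ^+ e * p ^+ d2) by rewrite exprMn; ring.
apply: is_idealD => //; last exact: is_idealM.
apply: is_idealMr => //; rewrite subrXX pE addrK; exact: is_idealMr.
Qed.

Variables (Kbar : closedFieldType) (jota : {rmorphism K -> Kbar}).
Hypothesis char_Kbar : [pchar Kbar] =i pred0.

Lemma saved_prime I t P : execution iota I t -> saved t P -> prime_ideal P.
Proof.
elim: t I => [E sigma l tau|i t1 IH1 t2 IH2] I /=.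
  move=> [Idata [tau_sat _]] [j ->].
  exact: (saturation_prime jota char_Kbar (tau_sat j)).
by move=> [_ e1 e2] [/(IH1 _ e1)|/(IH2 _ e2)].
Qed.

Lemma saved_sup I t P : is_ideal I -> execution iota I t -> saved t P ->
  ideal_extension iota I `<=` P.
Proof.
elim: t I => [E sigma l tau|i t1 IH1 t2 IH2] I Iid /=.
  move=> [Idata [tau_sat _]] [j ->].
  apply: ideal_extension_sub => [|p Ip]; first exact: ideal_P_is_ideal.
  apply: (ideal_P_saturation (tau_sat j)).
  have <- := cell_radical (jota \o iota) char_Kbar Iid Idata.
  exact: sub_radical.
have ext_mono J : I `<=` J -> ideal_extension iota I `<=` ideal_extension iota J.
  move=> IJ; apply: ideal_extension_sub; first exact: ideal_extension_is_ideal.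
  by move=> p /IJ; apply: map_mpoly_ideal_extension.
move=> [_ e1 e2] [tP|tP].
  apply: subset_trans (IH1 _ (split_add_is_ideal i Iid) e1 tP).
  by apply: ext_mono; apply: sub_split_add.
apply: subset_trans (IH2 _ (split_sat_is_ideal i Iid) e2 tP).
by apply: ext_mono; apply: sub_saturate.
Qed.

Lemma bigcap_saved_sub_radical I t p : is_ideal I -> execution iota I t ->
  large_enough iota jota t -> (forall P, saved t P -> P p) ->
  radical (ideal_extension iota I) p.
Proof.
elim: t I => [E sigma l tau|i t1 IH1 t2 IH2] I Iid /=.
  move=> [Idata tau_all] sdo tp.
  apply: (bigcap_saturations_sub_radical Idata char_Kbar tau_all sdo) => j.
  by apply: tp; exists j.
move=> [_ e1 e2] [le1 le2] tp; apply: (radical_split (i := i)) => //.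
  by apply: (IH1 _ (split_add_is_ideal i Iid)) => // P tP; apply: tp; left.
by apply: (IH2 _ (split_sat_is_ideal i Iid)) => // P tP; apply: tp; right.
Qed.

(** The saved ideals are primes over the extended ideal, and each prime over it
   contains one of them; so the minimal elements of both collections agree. *)
Lemma remaining_minimal_primes I t : is_ideal I -> execution iota I t ->
  large_enough iota jota t ->
  remaining (saved t) = minimal_primes (ideal_extension iota I).
Proof.
move=> Iid et let_.
have below Q : prime_ideal Q -> ideal_extension iota I `<=` Q ->
    exists2 P, saved t P & P `<=` Q.
  move=> Qp IQ; apply: saved_sub_prime => // p /(bigcap_saved_sub_radical Iid et let_).
  exact: radical_sub_prime.
apply/seteqP; split=> P.
  move=> [tP Pmin]; split; [exact: saved_prime et tP|exact: saved_sup et tP|].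
  move=> Q Qp IQ QP; have [P' tP' P'Q] := below Q Qp IQ.
  have P'P : P' = P by apply: Pmin => //; apply: subset_trans QP.
  by apply/seteqP; split=> //; rewrite -P'P.
move=> [Pp IP Pmin]; have [P' tP' P'P] := below P Pp IP.
have e : P' = P.
  by apply: Pmin => //; [exact: saved_prime et tP'|exact: saved_sup et tP'].
rewrite e in tP'; split=> // Q tQ QP; apply: Pmin => //.
  exact: saved_prime et tQ.
exact: saved_sup et tQ.
Qed.

Lemma bigcap_remaining I t : is_ideal I -> execution iota I t ->
  large_enough iota jota t ->
  \bigcap_(P in remaining (saved t)) P = radical (ideal_extension iota I).
Proof.
move=> Iid et let_; apply/seteqP; split=> p.
  move=> tp; apply: (bigcap_saved_sub_radical Iid et let_) => P tP.
  by have [Q /tp Qp] := saved_has_remaining tP; apply.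
move=> Ip P [tP _]; apply: radical_sub_prime Ip; first exact: saved_prime et tP.
exact: saved_sup et tP.
Qed.

End Traces.


(** * The minimal primes of a binomial ideal *)

Theorem mainTheorem2 (k : fieldType) (n : nat) (char_k : [pchar k] =i pred0)
    (I : set {mpoly k[n]}) (I_binomial : binomial_ideal I) (I_proper : is_proper I)
    (K : fieldType) (iota : {rmorphism k -> K})
    (Kbar : closedFieldType) (jota : {rmorphism K -> Kbar})
    (Kbar_algebraic : forall z : Kbar, algebraicOver jota z) :
  [/\ terminates iota I,
      (forall J E (sigma : partial_character k E),
         reachable I J -> cell_data J sigma ->
         radical J
           = ideal_add (ideal_span (J `&` subring_in E)) (ideal_M E) /\
         radical J = ideal_P sigma)
    & forall t : trace k K n,
        execution iota I t ->
        large_enough iota jota t ->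
        [/\ (forall P, saved t P -> prime_ideal P),
            remaining (saved t) = minimal_primes (ideal_extension iota I)
          & \bigcap_(P in remaining (saved t)) P
              = radical (ideal_extension iota I)]].
Proof.
pose f : {rmorphism k -> Kbar} := jota \o iota.
have char_Kbar : [pchar Kbar] =i pred0 by move=> p; rewrite (fmorph_pchar f) char_k.
have I_pb : proper_binomial I by [].
have I_ideal := binomial_ideal_is_ideal I_binomial.
split.
- split; first exact: recursive_call_wf.
  by move=> J /reachable_proper_binomial/(_ I_pb); apply: execution_exists.
- move=> J E sigma /reachable_proper_binomial/(_ I_pb)[Jb _] J_data.
  have Jid := binomial_ideal_is_ideal Jb.
  split; first exact: (cell_radical_span f char_Kbar Jid J_data).
  exact: (cell_radical f char_Kbar Jid J_data).
move=> t et t_large; split.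
- by move=> P; apply: (saved_prime jota) et.
- exact: remaining_minimal_primes t_large.
- exact: bigcap_remaining t_large.
Qed.
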